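(* Let $Z\subset\mathbb{P}^2$ be a finite set of $r$ points and let $k\ge5$ be an integer. If $p$ is an integer such that $$\alpha(I(Z))=p,\ \alpha(I(2Z))=p+2,\ \dots,\ \alpha(I(kZ))=p+2(k-1),$$ then $p=2$, i.e. the points of $Z$ are contained in a single conic.
   Context: Work over an algebraically closed field $\mathbb{K}$ of characteristic zero, $R=\mathbb{K}[x_0,x_1,x_2]$. For $Z=\{P_1,\dots,P_r\}$, $I(P_i)$ is the homogeneous maximal ideal of $P_i$ and $I(jZ)=I(P_1)^j\cap\dots\cap I(P_r)^j$ (the $j$-th symbolic power of $I(Z)=I(1Z)$). For a homogeneous ideal $J$, $\alpha(J)=\min\{n:J_n\ne0\}$ is its initial degree. *)

(* Defs.v *)
From HB Require Import structures.
From mathcomp Require Import all_boot all_order all_algebra.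
From mathcomp Require Import mpoly.
Set Implicit Arguments. Unset Strict Implicit. Unset Printing Implicit Defensive.
Import GRing.Theory.
Local Open Scope ring_scope.

(* R = K[x_0,x_1,x_2] is {mpoly K[3]}; a point of P^2 is represented by a
   nonzero vector of homogeneous coordinates P : 'rV[K]_3. *)

Section Defs.
Variable K : fieldType.

Definition ideal_gen (S : {mpoly K[3]} -> Prop) (f : {mpoly K[3]}) : Prop :=
  exists s : seq ({mpoly K[3]} * {mpoly K[3]}),
    (forall gh, gh \in s -> S gh.2) /\ f = \sum_(gh <- s) gh.1 * gh.2.

Definition ideal_pow (J : {mpoly K[3]} -> Prop) (j : nat) : {mpoly K[3]} -> Prop :=
  ideal_gen (fun h => exists hs : seq {mpoly K[3]},
                size hs = j /\ (forall q, q \in hs -> J q) /\ h = \prod_(q <- hs) q).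

Definition ev (P : 'rV[K]_3) (f : {mpoly K[3]}) : K := f.@[fun i => P ord0 i].

Definition IP (P : 'rV[K]_3) : {mpoly K[3]} -> Prop :=
  ideal_gen (fun h => exists d : nat, h \is d.-homog /\ ev P h = 0).

Definition IjZ (Z : seq 'rV[K]_3) (j : nat) (f : {mpoly K[3]}) : Prop :=
  forall P, P \in Z -> ideal_pow (IP P) j f.

Definition is_initial_degree (J : {mpoly K[3]} -> Prop) (n : nat) : Prop :=
  (exists f, f != 0 /\ f \is n.-homog /\ J f) /\
  (forall (m : nat) f, (m < n)%N -> f \is m.-homog -> J f -> f = 0).

End Defs.

(* Main.v *)
(** The main tool is Bezout's inequality with multiplicities, in the form: if D
    has degree d and multiplicities m_i at the points P_i, and the forms F_j of
    degree e with multiplicities a_i have no common annihilator modulo D, then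
    sum a_i m_i <= e d.  By McCoy's theorem some combination F of the F_j is
    regular modulo D, and the dimension of (F, D) in a large degree is compared
    with the number of conditions imposed by the multiplicities a_i + m_i.

    If no form of degree p - 1 vanishes on Z, choose p (p + 1) / 2 points of Z
    with a dual basis S_i of the forms of degree p - 1.  The products of S_i with
    a line through P_i give p (p + 8) >= 5 p (p + 1) / 2 for the curve of degree
    p + 8 with multiplicity 5 along Z, hence p <= 3.

    For p = 3 there remain six points of Z on no conic and a curve of degree 11
    with multiplicity 5.  If three of the six are not collinear and their joining
    lines avoid the other three, the quartics with double points at these three
    and simple points at the others contradict 4 * 11 < 9 * 5.  Otherwise the six
    points are the vertices of a complete quadrilateral.  A further point of Z is
    excluded by the same inequality, and if there is none then the four sides
    form a quartic that is double along Z, against alpha (I (2 Z)) = 5.  For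
    p <= 1 the square of a form of degree p in I(Z) has degree 2 p < p + 2. *)

Require Import Defs.
From HB Require Import structures.
From mathcomp Require Import all_boot all_order all_algebra.
From mathcomp Require Import mpoly ring zify.
Local Open Scope ring_scope.

Set Implicit Arguments. Unset Strict Implicit. Unset Printing Implicit Defensive.
Import GRing.Theory.

(** * Divisibility in a commutative ring *)

Definition divides (A : comNzRingType) (d x : A) : Prop := exists q, x = q * d.

Section Divides.
Variable A : comNzRingType.
Implicit Types d x y : A.

Lemma divides0 d : divides d 0.
Proof. by exists 0; rewrite mul0r. Qed.

Lemma dividesMl d x y : divides d x -> divides d (y * x).
Proof. by case=> q ->; exists (y * q); rewrite mulrA. Qed.

Lemma dividesMr d x y : divides d x -> divides d (x * y).
Proof. by rewrite mulrC; apply: dividesMl. Qed.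

Lemma divides_refl d : divides d d.
Proof. by exists 1; rewrite mul1r. Qed.

Lemma dividesD d x y : divides d x -> divides d y -> divides d (x + y).
Proof. by case=> q -> [r ->]; exists (q + r); rewrite mulrDl. Qed.

Lemma dividesB d x y : divides d x -> divides d y -> divides d (x - y).
Proof. by case=> q -> [r ->]; exists (q - r); rewrite mulrBl. Qed.

Lemma divides_sum (I : Type) (r : seq I) (Q : pred I) d (F : I -> A) :
  (forall i, Q i -> divides d (F i)) -> divides d (\sum_(i <- r | Q i) F i).
Proof. by move=> h; elim/big_ind: _ => //; [exact: divides0 | move=> x y; exact: dividesD]. Qed.

Lemma dividesM d1 d2 x y : divides d1 x -> divides d2 y -> divides (d1 * d2) (x * y).
Proof. by case=> q -> [r ->]; exists (q * r); rewrite mulrACA. Qed.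

End Divides.

(** * Regular polynomials modulo an element *)

Section McCoy.
Variable A : comNzRingType.
Implicit Types d x y : A.

Lemma divides_coef d (g : {poly A}) m : divides d%:P g -> divides d g`_m.
Proof. by case=> q ->; exists q`_m; rewrite coefMC. Qed.

Lemma divides_polyC d x : divides d x -> divides d%:P x%:P.
Proof. by case=> q ->; exists q%:P; rewrite polyCM. Qed.

(* McCoy's theorem for the polynomials over A / (d). *)
Lemma mccoy d (f : {poly A}) :
    (forall x, (forall i, divides d (f`_i * x)) -> divides d x) ->
  forall g : {poly A}, divides d%:P (f * g) -> divides d%:P g.
Proof.
move=> reg g; have [n] := ubnP (size g); elim: n g => // n IHn g szg fg.
have [->|g_neq0] := eqVneq g 0; first exact: divides0.
pose b := lead_coef g; pose m := (size g).-1.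
have szgS : size g = m.+1 by rewrite prednK // size_poly_gt0.
pose g' := g - b%:P * 'X^m.
have gE : g = g' + b%:P * 'X^m by rewrite subrK.
have g'lt c : (size (c%:P * g')%R < n)%N.
  apply: (@leq_ltn_trans m); last by rewrite -ltnS -szgS.
  apply/leq_sizeP => j mj; rewrite coefCM /g' coefB coefCM coefXn.
  case: (ltngtP m j) mj => // [mj|<-] _; last first.
    by rewrite mulr1 /b /lead_coef -/m subrr mulr0.
  by rewrite mulr0 subr0 nth_default ?mulr0 // szgS.
(* Downward induction on [i]. In the coefficient of [f * g] at [i + m], the terms with [j < i] are
   zero since [g] has degree [m], and those with [j > i] are divisible by induction, so the term
   containing [b] is divisible too. The remaining product with [g'] is shorter than [g] and falls
   under [IHn]. *)
have fcoef i : divides d%:P ((f`_i)%:P * g) /\ divides d (f`_i * b).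
  have [k] := ubnP (size f - i)%N; elim: k i => // k IHk i ki.
  have top : divides d (f`_i * b).
    have lt_i : (i < (i + m).+1)%N by rewrite ltnS leq_addr.
    have := coefM f g (i + m); rewrite (bigD1 (Ordinal lt_i)) //= addKn => e.
    rewrite -[f`_i * b](addrK (\sum_(j < (i + m).+1 | j != Ordinal lt_i) f`_j * g`_(i + m - j))).
    rewrite -e; apply: dividesB; first exact: divides_coef.
    apply: divides_sum => j; rewrite -val_eqE /= => jNi.
    case: (ltngtP j i) jNi => // [ji|ij] _.
      rewrite (_ : g`__ = 0) ?mulr0; first exact: divides0.
      by rewrite nth_default // szgS ltn_subRL ltn_add2r.
    have [szj|szj] := leqP (size f) j.
      by rewrite nth_default // mul0r; exact: divides0.
    rewrite -coefCM; apply: divides_coef; apply: (IHk _ _).1.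
    by rewrite ltnS in ki; apply: leq_trans ki; rewrite ltn_sub2l // (ltn_trans ij).
  split=> //; rewrite [X in _ * X]gE mulrDr; apply: dividesD; last first.
    by rewrite mulrA -polyCM; apply/dividesMr/divides_polyC.
  apply: IHn => //; rewrite mulrCA mulrBr mulrBr; apply: dividesB.
    exact: dividesMl.
  by rewrite mulrCA; apply: dividesMl; rewrite mulrA -polyCM; apply/dividesMr/divides_polyC.
have db : divides d%:P b%:P by apply/divides_polyC/reg => i; apply: (fcoef i).2.
rewrite gE; apply: dividesD; last exact: dividesMr.
rewrite -[g']mul1r; apply: IHn; first exact: g'lt.
by rewrite mul1r mulrBr; apply: dividesB => //; apply/dividesMl/dividesMr.
Qed.
End McCoy.

(** * Specializing a parameter without losing linear independence *)

Lemma fraction_clear (A : idomainType) (x : {fraction A}) :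
  exists2 d : A, d != 0 & exists n : A, FracField.tofrac d * x = FracField.tofrac n.
Proof.
elim/quotW: x => x; exists \d_x; first exact: denom_ratioP.
exists \n_x; unlock FracField.tofrac.
rewrite -[LHS]FracField.pi_mul; apply/eqmodP => /=.
rewrite FracField.equivfE /FracField.mulf /= !numden_Ratio ?(oner_neq0, mul1r, mulr1, denom_ratioP) // mulrC.
Qed.

Lemma fraction_mx_clear (A : idomainType) (m n : nat) (B : 'M[{fraction A}]_(m, n)) :
  exists2 d : A, d != 0 &
    exists C : 'M[A]_(m, n), FracField.tofrac d *: B = map_mx (@FracField.tofrac A) C.
Proof.
have /fin_all_exists2 [d d_neq0 dB] (ij : 'I_m * 'I_n) := fraction_clear (B ij.1 ij.2).
have /fin_all_exists [c cE] := dB.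
exists (\prod_ij d ij); first by apply/prodf_neq0 => ij _; exact: d_neq0.
exists (\matrix_(i, j) ((\prod_(ij | ij != (i, j)) d ij) * c (i, j))).
apply/matrixP => i j; rewrite !mxE (bigD1 (i, j)) //= [in RHS]rmorphM /= -cE /= [in LHS]rmorphM /=.
by rewrite mulrA [X in X * _]mulrC.
Qed.

(** Over the fraction field [M] has a right inverse. Clearing denominators gives [M *m C = d%:M]
    with [d != 0], and any [t] that is not a root of [d] keeps the specialized matrix right
    invertible. *)
Lemma row_free_specialization (K : closedFieldType) (m n : nat)
    (M : 'M[{poly K}]_(m, n)) :
    (forall v : 'rV_m, v *m M = 0 -> v = 0) ->
  exists t : K, row_free (map_mx (horner_eval t) M).
Proof.
move=> injM; pose F : {rmorphism {poly K} -> {fraction {poly K}}} := @FracField.tofrac {poly K}.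
have F_inj r s (B C : 'M[{poly K}]_(r, s)) : map_mx F B = map_mx F C -> B = C.
  move=> /matrixP BC; apply/matrixP => i j; have /eqP := BC i j.
  by rewrite !mxE tofrac_eq => /eqP.
have : row_free (map_mx F M).
  apply: inj_row_free => v vM; have [d d_neq0 [u uE]] := fraction_mx_clear v.
  have u0 : u = 0.
    apply: injM; apply: F_inj.
    by rewrite map_mxM -uE -scalemxAl vM scaler0 map_mx0.
  apply/eqP; have /eqP := uE; rewrite u0 map_mx0 scalemx_eq0 => /orP[]//.
  by rewrite tofrac_eq0 (negPf d_neq0).
case/row_freeP => B MB; have [d d_neq0 [C CE]] := fraction_mx_clear B.
have MC : M *m C = d%:M.
  apply: F_inj.
  by rewrite map_mxM -CE -scalemxAr MB map_scalar_mx scalemx1.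
have [t tP] := closed_nonrootP d d_neq0.
exists t; apply/row_freeP; exists (d.[t]^-1 *: map_mx (horner_eval t) C).
rewrite -scalemxAr -map_mxM MC map_scalar_mx /= -scalemx1 scalerA /horner_eval.
by rewrite mulVf ?scale1r.
Qed.

Section GenericFree.
Variables (K : closedFieldType) (n : nat).
Implicit Type w : {poly {mpoly K[n]}}.

Lemma mcoeff_horner w (t : K) (m : 'X_{1..n}) :
  (w.[t%:MP])@_m = (map_poly (mcoeff m) w).[t].
Proof.
rewrite horner_coef raddf_sum (@horner_coef_wide _ (size w)) ?size_poly //=.
apply: eq_bigr => i _; rewrite coef_map_id0 ?mcoeff0 //.
by rewrite -rmorphXn /= mulrC mul_mpolyC mcoeffZ mulrC.
Qed.

Lemma mcoeff_mul_mpolyC (v : {poly K}) w (m : 'X_{1..n}) :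
  map_poly (mcoeff m) (map_poly (@mpolyC n K) v * w) = v * map_poly (mcoeff m) w.
Proof.
apply/polyP => k; rewrite coef_map_id0 ?mcoeff0 // !coefM raddf_sum /=.
by apply: eq_bigr => i _; rewrite coef_map /= mul_mpolyC mcoeffZ coef_map_id0 ?mcoeff0.
Qed.

(** Independence over K[t] survives at some value of t: specialize the matrix whose row [i] lists
    the coefficients of [w i], one column per monomial. *)
Lemma generic_free (a : nat) (w : 'I_a -> {poly {mpoly K[n]}}) :
    (forall v : 'I_a -> {poly K},
       \sum_i map_poly (@mpolyC n K) (v i) * w i = 0 -> forall i, v i = 0) ->
  exists t : K, forall c : 'I_a -> K,
    \sum_i c i *: (w i).[t%:MP] = 0 -> forall i, c i = 0.
Proof.
move=> indep.
(* [N] exceeds the degree of every monomial that occurs, so finitely many columns suffice. *)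
pose N := \max_(i < a) \max_(k < size (w i)) msize (w i)`_k.
have wN i k (m : 'X_{1..n}) : (N <= mdeg m)%N -> ((w i)`_k)@_m = 0.
  move=> Nm; have [szk|szk] := leqP (size (w i)) k.
    by rewrite nth_default // mcoeff0.
  apply/eqP; rewrite mcoeff_eq0; apply: contraL Nm => /msize_mdeg_lt lt_m.
  rewrite -ltnNge; apply: leq_trans lt_m _.
  apply: leq_trans (leq_bigmax i).
  exact: (@leq_bigmax _ (fun k : 'I_(size (w i)) => msize (w i)`_k) (Ordinal szk)).
pose M := \matrix_(i < a, j < #|{: 'X_{1..n < N}}|) map_poly (mcoeff (enum_val j)) (w i).
have [v vM|t freeM] := @row_free_specialization K _ _ M.
  have v0 : forall i, v 0 i = 0.
    apply: indep; apply/polyP => k; apply/mpolyP => m; rewrite coef0 mcoeff0.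
    have -> : ((\sum_i map_poly (@mpolyC n K) (v 0 i) * w i)`_k)@_m
       = (\sum_i v 0 i * map_poly (mcoeff m) (w i))`_k.
      rewrite !coef_sum raddf_sum; apply: eq_bigr => i _ /=.
      by rewrite -mcoeff_mul_mpolyC coef_map_id0 ?mcoeff0.
    have [mN|Nm] := ltnP (mdeg m) N.
      have := congr1 (fun A : 'rV[{poly K}]_(_) => (A 0 (enum_rank (BMultinom mN)))`_k) vM.
      rewrite [in RHS]mxE coef0 => h; rewrite -[RHS]h mxE !coef_sum; apply: eq_bigr => i _.
      by rewrite !mxE enum_rankK.
    rewrite coef_sum big1 // => i _.
    rewrite (_ : map_poly _ _ = 0) ?mulr0 ?coef0 //.
    by apply/polyP => j; rewrite coef_map_id0 ?mcoeff0 // wN // coef0.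
  by apply/rowP => i; rewrite v0 mxE.
exists t => c c0 i; have /row_free_inj injM := freeM.
suff: \row_i c i = 0 by move/rowP/(_ i); rewrite !mxE.
apply: injM; rewrite mul0mx; apply/rowP => j; rewrite !mxE.
have := congr1 (mcoeff (enum_val j)) c0; rewrite mcoeff0 raddf_sum /= => {2}<-.
by apply: eq_bigr => k _; rewrite !mxE mcoeffZ mcoeff_horner.
Qed.
End GenericFree.

(** * Homogeneous components of products and quotients *)

Section Homogeneous.
Variables (K : fieldType) (n : nat).
Implicit Types f q : {mpoly K[n]}.

Lemma pihomogM f q d k : f \is d.-homog ->
  pihomog mdeg (d + k)%N (f * q) = f * pihomog mdeg k q.
Proof.
move=> hf; pose N := maxn (msize q) k.+1.
have kN : (k < N)%N by rewrite leq_max leqnn orbT.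
rewrite [X in f * X](@pihomog_partitionE _ _ mdeg N q) ?leq_maxl //.
rewrite mulr_sumr raddf_sum /= (bigD1 (Ordinal kN)) //= pihomog_dE; last first.
  by apply: dhomogM => //; exact: pihomogP.
rewrite big1 ?addr0 // => j; rewrite -val_eqE /= => jk.
apply: (@pihomog_ne0 _ _ mdeg (d + j)%N); first by rewrite eqn_add2l.
by apply: dhomogM => //; exact: pihomogP.
Qed.

(** Multiplication by [f] is injective and shifts homogeneous components by [d], so [q] has no
    component outside degree [k - d]. *)
Lemma dhomog_quotient f q d k : f != 0 -> q != 0 -> f \is d.-homog ->
  f * q \is k.-homog -> (d <= k)%N /\ q \is (k - d)%N.-homog.
Proof.
move=> f0 q0 hf hfq.
have qj j : (d + j != k)%N -> pihomog mdeg j q = 0.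
  move=> dj; apply/eqP; rewrite -(mulrI_eq0 _ (mulfI f0)) -(pihomogM _ _ hf).
  by rewrite (@pihomog_ne0 _ _ mdeg k) // eq_sym.
have qE := @pihomog_partitionE _ _ mdeg _ q (leqnn _).
have [dk|kd] := leqP d k; last first.
  case/eqP: q0; rewrite qE big1 // => j _; apply: qj.
  by rewrite gtn_eqF // ltn_addr.
split=> //; rewrite qE; apply: rpred_sum => j _.
have [<-|djk] := eqVneq (d + j)%N k; first by rewrite addKn; exact: pihomogP.
by rewrite qj // rpred0.
Qed.
End Homogeneous.

(** * Linear forms and their primality *)

Section LinearForms.
Variable K : fieldType.
Implicit Types (c P : 'rV[K]_3) (f g : {mpoly K[3]}).

Definition dot c (P : 'rV[K]_3) := \sum_i c ord0 i * P ord0 i : K.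
Definition lin c : {mpoly K[3]} := \sum_i c ord0 i *: 'X_i.

Lemma lin_homog c : lin c \is 1.-homog.
Proof. by apply: rpred_sum => i _; rewrite rpredZ // dhomogX /= mdeg1. Qed.

Lemma ev_lin c P : ev P (lin c) = dot c P.
Proof.
by rewrite /ev raddf_sum; apply: eq_bigr => i _ /=; rewrite mevalZ mevalXU.
Qed.

Lemma mcoeff_lin c i : (lin c)@_(U_(i)) = c ord0 i.
Proof.
rewrite raddf_sum (bigD1 i) //= big1 => [|j ji]; rewrite mcoeffZ mcoeffXU.
  by rewrite eqxx mulr1 addr0.
by rewrite (negPf ji) mulr0.
Qed.

Lemma lin_eq0 c : (lin c == 0) = (c == 0).
Proof.
apply/eqP/eqP => [c0|->]; last by rewrite /lin big1 // => i _; rewrite mxE scale0r.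
by apply/rowP => i; rewrite -mcoeff_lin c0 mcoeff0 mxE.
Qed.

Lemma ev_homogZ f d P (a : K) : f \is d.-homog -> ev (a *: P) f = a ^+ d * ev P f.
Proof.
move=> /dhomogP hf; rewrite /ev !mevalE mulr_sumr !big_seq; apply: eq_bigr => m mf.
have <- : mdeg m = d by exact: hf.
rewrite mulrCA; congr (_ * _); rewrite mdegE -prodrXr -big_split /=.
by apply: eq_bigr => i _; rewrite mxE exprMn.
Qed.

(* Eliminating a variable with the equation [lin c = 0] embeds the quotient in
   the polynomial ring, which is a domain. *)
Lemma lin_prime c f g : c != 0 -> divides (lin c) (f * g) ->
  divides (lin c) f \/ divides (lin c) g.
Proof.
move=> c_neq0 [h fgE].
have /rV0Pn [k ck] := c_neq0.
(* [r] solves [lin c = 0] for the variable of index [k]: it kills [lin c] and changes every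
   polynomial by a multiple of [lin c]. *)
pose r : {rmorphism {mpoly K[3]} -> {mpoly K[3]}} :=
  mmap (@mpolyC 3 K) (fun i => 'X_i - (i == k)%:R *: ((c ord0 k)^-1 *: lin c)).
have rX i : r 'X_i = 'X_i - (i == k)%:R *: ((c ord0 k)^-1 *: lin c).
  by rewrite /r /= mmapX mmap1U.
have rC a : r a%:MP = a%:MP by rewrite /r /= mmapC.
have rZ a p : r (a *: p) = a *: r p by rewrite -!mul_mpolyC rmorphM /= rC.
have r0 : r (lin c) = 0.
  rewrite {1}/lin raddf_sum /= (eq_bigr (fun i => c ord0 i *: 'X_i -
     c ord0 i *: ((i == k)%:R *: ((c ord0 k)^-1 *: lin c)))); last first.
    by move=> i _; rewrite rZ rX scalerBr.
  rewrite big_split /= -/(lin c) sumrN (bigD1 k) //= big1 => [|i /negPf ->].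
    by rewrite eqxx scale1r scalerA divff // scale1r addr0 subrr.
  by rewrite scale0r scaler0.
have rdiv p : divides (lin c) (p - r p).
  elim/mpolyind: p => [|a m p _ _ IHp]; first by rewrite rmorph0 subrr; exact: divides0.
  rewrite rmorphD opprD addrACA; apply: dividesD; last exact: IHp.
  rewrite rZ -scalerBr.
  rewrite -mul_mpolyC; apply: dividesMl; rewrite mpolyXE_id rmorph_prod /=.
  elim/big_ind2: _ => [|x1 x2 y1 y2 h1 h2|i _].
  - by rewrite subrr; exact: divides0.
  - rewrite [X in divides _ X](_ : _ = (x2 - x1) * y2 + x1 * (y2 - y1)); last first.
      by rewrite mulrBl mulrBr addrA subrK.
    by apply: dividesD; [exact: dividesMr | exact: dividesMl].
  rewrite -[mmap _ _ _]/(r _) rmorphXn subrXX; apply: dividesMr; rewrite rX opprB addrC subrK.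
  by rewrite -mul_mpolyC -mul_mpolyC; do 2 apply: dividesMl; exact: divides_refl.
have : r f * r g = 0 by rewrite -rmorphM fgE rmorphM /= r0 mulr0.
by move/eqP; rewrite mulf_eq0 => /orP[]/eqP r_0; [left | right];
  [have := rdiv f | have := rdiv g]; rewrite r_0 subr0.
Qed.

(** A linear form that does not divide [D] is regular modulo [D]: being prime, it divides the
    cofactor of [D] and cancels there. *)
Lemma lin_cancel c D g : c != 0 -> ~ divides (lin c) D ->
  divides D (lin c * g) -> divides D g.
Proof.
move=> c0 cD [h cgE]; have [|[q hE]|//] := @lin_prime c h D c0.
  by exists g; rewrite -cgE mulrC.
exists q; apply: (mulfI (x := lin c)); first by rewrite lin_eq0.
by rewrite cgE hE mulrAC mulrC.
Qed.
End LinearForms.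

(** * Local expansions at a point *)

Lemma divides_XnP (A : comNzRingType) m (p : {poly A}) :
  divides 'X^m p <-> forall k, (k < m)%N -> p`_k = 0.
Proof.
split=> [[q ->] k km|p0]; first by rewrite coefMXn km.
exists (drop_poly m p); rewrite -{1}(poly_take_drop m p) [take_poly m p](_ : _ = 0) ?add0r //.
apply/polyP => k; rewrite coef_take_poly coef0.
by case: ltnP => // /p0.
Qed.

(** The low coefficients of [q] vanish one after the other: once those below [k] do, the coefficient
    of [p * q] at [k] is that of [q] times the nonzero constant term of [p]. *)
Lemma divides_Xn_unit (A : idomainType) m (p q : {poly A}) : p`_0 != 0 ->
  divides 'X^m (p * q) -> divides 'X^m q.
Proof.
move=> p0 /divides_XnP pq; apply/divides_XnP => k.
elim/ltn_ind: k => k IHk km; have := pq k km; rewrite coefM big_ord_recl subn0 big1.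
  by move/eqP; rewrite addr0 mulf_eq0 (negPf p0) => /eqP.
move=> i _; rewrite IHk ?mulr0 //; last exact: leq_ltn_trans (leq_subr _ _) km.
by rewrite lift0 ltn_subrL (leq_ltn_trans _ (ltn_ord i)).
Qed.

Section Jets.
Variable K : fieldType.
Implicit Types (c P : 'rV[K]_3) (f g : {mpoly K[3]}) (M : 'M[K]_3).

Definition o0 : 'I_3 := @Ordinal 3 0 isT.
Definition o1 : 'I_3 := @Ordinal 3 1 isT.
Definition o2 : 'I_3 := @Ordinal 3 2 isT.

(** A chart of the blow-up at the point [row o0 M]: the inner variable is the slope of a line
    through the point, the outer one the parameter along that line. *)
Definition jetpt M (i : 'I_3) : {poly {poly K}} :=
  (M o0 i)%:P%:P + ((M o1 i)%:P + (M o2 i)%:P * 'X)%:P * 'X.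

(* The expansion of f at the point of homogeneous coordinates [row 0 M]: the
   other two rows give affine coordinates around it, and the coefficient of
   'X^k is the part of degree k, dehomogenized. *)
Definition jet M f : {poly {poly K}} := mmap (polyC \o polyC) (jetpt M) f.

HB.instance Definition _ M :=
  GRing.RMorphism.copy (jet M) (mmap (polyC \o polyC) (jetpt M)).

Definition vanishes M m f := divides 'X^m (jet M f).

Lemma jetC M a : jet M a%:MP = a%:P%:P.
Proof. by rewrite /jet mmapC. Qed.

Lemma jetX M i : jet M 'X_i = jetpt M i.
Proof. by rewrite /jet mmapX mmap1U. Qed.

Lemma jetZ M a f : jet M (a *: f) = a%:P%:P * jet M f.
Proof. by rewrite -mul_mpolyC rmorphM /= jetC. Qed.

Lemma jet_lin M c : jet M (lin c) = (dot c (row o0 M))%:P%:P +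
  ((dot c (row o1 M))%:P + (dot c (row o2 M))%:P * 'X)%:P * 'X.
Proof.
rewrite /lin /dot raddf_sum /=.
under eq_bigr do rewrite jetZ jetX /jetpt mulrDr mulrA -!polyCM mulrDr mulrA -!polyCM.
rewrite big_split /= -mulr_suml; congr (_ + _ * _).
  by rewrite !rmorph_sum; apply: eq_bigr => i _; rewrite mxE.
rewrite -rmorph_sum big_split /= -mulr_suml !rmorph_sum; congr (polyC (_ + _ * _)).
  by apply: eq_bigr => i _; rewrite mxE.
by apply: eq_bigr => i _; rewrite mxE.
Qed.

Lemma jet_coef0 M f : (jet M f)`_0 = (ev (row o0 M) f)%:P.
Proof.
elim/mpolyind: f => [|a m f _ _ IHf].
  by rewrite rmorph0 coef0 /ev meval0.
rewrite rmorphD /= coefD IHf /ev mevalD polyCD; congr (_ + _).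
rewrite jetZ coefCM mevalZ polyCM; congr (_ * _).
rewrite -horner_coef0 mpolyXE_id !rmorph_prod -/(horner_eval 0 _) rmorph_prod /=.
apply: eq_bigr => i _; rewrite !rmorphXn /= jetX /horner_eval /jetpt !hornerE.
by rewrite mevalXU mxE.
Qed.

(** In [jetpt] every slope variable is accompanied by an outer variable, so the part of order [k]
    has degree at most [k] in the slope. This bounds the number of conditions imposed by a
    multiplicity. *)
Lemma jet_size M f k : (size ((jet M f)`_k)%R <= k.+1)%N.
Proof.
have szM (p q : {poly {poly K}}) : (forall k, (size (p`_k)%R <= k.+1)%N) ->
    (forall k, (size (q`_k)%R <= k.+1)%N) -> forall k, (size ((p * q)`_k)%R <= k.+1)%N.
  move=> hp hq j; rewrite coefM; apply: leq_trans (size_sum _ _ _) _.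
  apply/bigmax_leqP => i _; apply: leq_trans (size_polyMleq _ _) _.
  have := leq_add (hp i) (hq (j - i)%N).
  by rewrite addSn addnS subnKC ?leq_ord // -!subn1 leq_subLR.
move: k; elim/mpolyind: f => [|a m f _ _ IHf] k; first by rewrite rmorph0 coef0 size_poly0.
rewrite rmorphD /= coefD; apply: leq_trans (size_polyD _ _) _; rewrite geq_max IHf andbT.
move: k; rewrite -mul_mpolyC rmorphM /=; apply: (szM) => [k|].
  rewrite jetC coefC; case: (k == 0)%N; last by rewrite size_poly0.
  by rewrite (leq_trans (size_polyC_leq1 _)).
rewrite mpolyXE_id rmorph_prod /=; apply: (big_ind (fun p : {poly {poly K}} => forall k, (size (p`_k)%R <= k.+1)%N))
  => [k|p q|i _].
- by rewrite coefC; case: (k == 0)%N; rewrite ?size_poly0 // size_poly1.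
- exact: (szM).
rewrite rmorphXn /= jetX; elim: (m i) => [|j IHj].
  move=> k; rewrite expr0 coefC.
  by case: (k == 0)%N; rewrite ?size_poly0 // size_poly1.
rewrite exprS; apply: (szM) => // k; rewrite /jetpt coefD coefMX !coefC.
case: k => [|[|k]] /=; rewrite ?addr0 ?add0r ?size_poly0 ?size_polyC_leq1 //.
by rewrite addrC size_MXaddC; case: ifP => // _; rewrite ltnS size_polyC_leq1.
Qed.
End Jets.

(** * Order of vanishing at a point *)

Section Vanishing.
Variable K : fieldType.
Implicit Types (c P Q X : 'rV[K]_3) (f g : {mpoly K[3]}) (M : 'M[K]_3).

Lemma vanishes0 M f : vanishes M 0 f.
Proof. by exists (jet M f); rewrite expr0 mulr1. Qed.

Lemma vanishesM M m k f g :
  vanishes M m f -> vanishes M k g -> vanishes M (m + k) (f * g).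
Proof. by move=> hf hg; rewrite /vanishes rmorphM exprD; exact: dividesM. Qed.

Lemma vanishesMl M m f g : vanishes M m g -> vanishes M m (f * g).
Proof. by move=> hg; rewrite -[m]add0n; apply: vanishesM => //; exact: vanishes0. Qed.

Lemma vanishes_leq M m k f : (m <= k)%N -> vanishes M k f -> vanishes M m f.
Proof.
move=> mk [q qE]; exists (q * 'X^(k - m)).
by rewrite -mulrA -exprD subnK.
Qed.

Lemma vanishes1 M f : ev (row o0 M) f = 0 -> vanishes M 1 f.
Proof. by move=> f0; apply/divides_XnP => -[|//] _; rewrite jet_coef0 f0. Qed.

Lemma vanishes_ev M m f : (0 < m)%N -> vanishes M m f -> ev (row o0 M) f = 0.
Proof.
by move=> m0 /divides_XnP/(_ 0%N m0); rewrite jet_coef0 => /eqP; rewrite polyC_eq0 => /eqP.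
Qed.

(** If the line misses the point, its jet has a nonzero constant term and cancels. Otherwise its jet
    is ['X] times a nonzero factor free of the outer variable, and only one order is lost. *)
Lemma vanishes_lin_quotient M m c g : M \in unitmx -> c != 0 ->
  vanishes M m (lin c * g) -> vanishes M (m - (dot c (row o0 M) == 0)) g.
Proof.
move=> Mu c0; rewrite /vanishes rmorphM /= jet_lin.
have [cP|cP] := eqVneq (dot c (row o0 M)) 0; last first.
  rewrite subn0; apply: divides_Xn_unit.
  by rewrite coefD coefMX coefC /= addr0 polyC_eq0.
(* Were [q] zero, [c] would be orthogonal to all three rows of the invertible matrix [M]. *)
set q := ((dot c (row o1 M))%:P + _); have q0 : q != 0.
  apply: contraNneq c0 => q0.
  have c1 : dot c (row o1 M) = 0.
    by have := congr1 (fun p : {poly K} => p`_0) q0; rewrite coefD coefMX coefC coef0 addr0.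
  have c2 : dot c (row o2 M) = 0.
    have := congr1 (fun p : {poly K} => p`_1) q0.
    by rewrite coef0 coefD coefMX !coefC add0r.
  have Mc : M *m c^T = 0.
    apply/colP => i; rewrite !mxE; rewrite -[RHS](_ : dot c (row i M) = 0).
      by apply: eq_bigr => j _; rewrite !mxE mulrC.
    case: i => -[|[|[|//]]] i3; [rewrite -[RHS]cP | rewrite -[RHS]c1 | rewrite -[RHS]c2];
    by congr (dot _ (row _ _)); exact: val_inj.
  by rewrite -[c]trmxK -(mulKmx Mu c^T) Mc mulmx0 trmx0.
rewrite cP add0r; case: m => [_|m [r rE]]; first by exists (jet M g); rewrite expr0 mulr1.
rewrite subn1 /=; apply: (@divides_Xn_unit _ _ q%:P); first by rewrite coefC.
exists r; apply: (mulIf (negbT (polyX_eq0 _))).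
by rewrite -[RHS]mulrA -exprSr -rE mulrAC.
Qed.

Lemma frame_exists P : P != 0 -> exists2 M, M \in unitmx & row o0 M = P.
Proof.
move=> P0; have rP : \rank P = 1 by apply/eqP; rewrite rank_rV P0.
pose a := col_ebase P 0 0; have a0 : a != 0.
  have := col_ebase_unit P; rewrite unitmxE [col_ebase P]mx11_scalar det_scalar expr1.
  by rewrite unitfE.
exists (a *: row_ebase P).
  by rewrite unitmxZ ?unitfE // row_ebase_unit.
rewrite -[RHS](mulmx_ebase P) rP [col_ebase P]mx11_scalar -/a -mulmxA mul_scalar_mx.
apply/rowP => j; rewrite !mxE (bigD1 o0) //= big1 => [|i i0]; rewrite !mxE /=.
  by rewrite mul1r addr0.
by rewrite -val_eqE /= in i0; rewrite eq_sym (negPf i0) mul0r.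
Qed.

(** The generators of [IP P] are zero at [P], so each of the [m] factors of a generating product has
    a jet divisible by ['X]. *)
Lemma ideal_pow_vanishes M P m f : row o0 M = P ->
  ideal_pow (IP P) m f -> vanishes M m f.
Proof.
move=> MP [s [sP ->]]; rewrite /vanishes rmorph_sum /= big_seq.
apply: divides_sum => -[g h] gh /=; rewrite rmorphM; apply: dividesMl.
have [hs /= [<- [hsP ->]]] := sP _ gh.
elim: hs hsP {gh} => [|q hs IHhs] hsP.
  by rewrite big_nil rmorph1 expr0; exact: divides_refl.
rewrite big_cons rmorphM exprS; apply: dividesM; last first.
  by apply: IHhs => r rhs; apply: hsP; rewrite inE rhs orbT.
have [t [tP ->]] := hsP q (mem_head _ _).
rewrite rmorph_sum /= big_seq; apply: divides_sum => -[a b] ab /=.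
rewrite rmorphM; apply: dividesMl; have [d /= [_ bP]] := tP _ ab.
by apply: vanishes1; rewrite MP.
Qed.

Lemma IP_ev P f d : f \is d.-homog -> ev P f = 0 -> IP P f.
Proof.
move=> hf fP; exists [:: (1, f)]; rewrite big_seq1 mul1r; split=> // gh.
by rewrite inE => /eqP ->; exists d.
Qed.

Lemma ideal_pow_prod P (hs : seq {mpoly K[3]}) g :
    (forall h, h \in hs -> IP P h) ->
  ideal_pow (IP P) (size hs) (g * \prod_(h <- hs) h).
Proof.
move=> hsP; exists [:: (g, \prod_(h <- hs) h)]; rewrite big_seq1; split=> // gh.
by rewrite inE => /eqP ->; exists hs.
Qed.

(** * Joining lines and collinearity in coordinates *)

Lemma dotE c P : dot c P = c ord0 o0 * P ord0 o0 + c ord0 o1 * P ord0 o1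
  + c ord0 o2 * P ord0 o2.
Proof.
rewrite /dot !big_ord_recl big_ord0 addr0 addrA.
by congr (_ + _ + _); congr (_ * _); congr (_ _ _); exact: val_inj.
Qed.

(** Read as the coefficients of a linear form, this is the line joining [P] and [Q]; it is zero
    exactly when they are proportional. *)
Definition cross P Q : 'rV[K]_3 := \row_i [::
  P ord0 o1 * Q ord0 o2 - P ord0 o2 * Q ord0 o1;
  P ord0 o2 * Q ord0 o0 - P ord0 o0 * Q ord0 o2;
  P ord0 o0 * Q ord0 o1 - P ord0 o1 * Q ord0 o0]`_i.

Definition det3 P Q X := dot (cross P Q) X.

Lemma det3E P Q X : det3 P Q X =
  (P ord0 o1 * Q ord0 o2 - P ord0 o2 * Q ord0 o1) * X ord0 o0 +
  (P ord0 o2 * Q ord0 o0 - P ord0 o0 * Q ord0 o2) * X ord0 o1 +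
  (P ord0 o0 * Q ord0 o1 - P ord0 o1 * Q ord0 o0) * X ord0 o2.
Proof. by rewrite /det3 dotE !mxE. Qed.

Lemma row3P P Q : P ord0 o0 = Q ord0 o0 -> P ord0 o1 = Q ord0 o1 ->
  P ord0 o2 = Q ord0 o2 -> P = Q.
Proof.
move=> h0 h1 h2; apply/rowP => -[[|[|[|//]]] i3].
- by have -> : Ordinal i3 = o0 by exact: val_inj.
- by have -> : Ordinal i3 = o1 by exact: val_inj.
- by have -> : Ordinal i3 = o2 by exact: val_inj.
Qed.

(** Cramer's rule: each coordinate of [c] times the determinant is a combination of the three values
    of [c]. *)
Lemma det3_lin c P Q X : c != 0 -> dot c P = 0 -> dot c Q = 0 -> dot c X = 0 ->
  det3 P Q X = 0.
Proof.
move=> c0 cP cQ cX; apply/eqP; apply: contraNT c0 => dPQX; apply/eqP.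
have cE i : c ord0 i * det3 P Q X = 0 -> c ord0 i = 0.
  by move/eqP; rewrite mulf_eq0 (negPf dPQX) orbF => /eqP.
have h0 : c ord0 o0 * det3 P Q X = dot c P * (cross Q X) ord0 o0
   + dot c Q * (cross X P) ord0 o0 + dot c X * (cross P Q) ord0 o0.
  by rewrite det3E !dotE !mxE /=; ring.
have h1 : c ord0 o1 * det3 P Q X = dot c P * (cross Q X) ord0 o1
   + dot c Q * (cross X P) ord0 o1 + dot c X * (cross P Q) ord0 o1.
  by rewrite det3E !dotE !mxE /=; ring.
have h2 : c ord0 o2 * det3 P Q X = dot c P * (cross Q X) ord0 o2
   + dot c Q * (cross X P) ord0 o2 + dot c X * (cross P Q) ord0 o2.
  by rewrite det3E !dotE !mxE /=; ring.
rewrite cP cQ cX !mul0r !addr0 in h0 h1 h2.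
by apply: row3P; rewrite [RHS]mxE; apply: cE.
Qed.

Lemma det3C P Q X : det3 Q P X = - det3 P Q X.
Proof. by rewrite !det3E; ring. Qed.

Lemma det3_rot P Q X : det3 Q X P = det3 P Q X.
Proof. by rewrite !det3E; ring. Qed.

Lemma det3_id P X : det3 P P X = 0.
Proof. by rewrite !det3E; ring. Qed.

Lemma cross_eq0 P Q : P != 0 -> cross P Q = 0 -> exists a, Q = a *: P.
Proof.
move=> P0 /rowP PQ.
have /eqP h0 := PQ o0; have /eqP h1 := PQ o1; have /eqP h2 := PQ o2.
rewrite !mxE /= !subr_eq0 in h0 h1 h2.
move: h0 h1 h2 => /eqP h0 /eqP h1 /eqP h2.
have [k Pk] : exists k, P ord0 k != 0 by apply/rV0Pn.
exists (Q ord0 k / P ord0 k).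
have e j : P ord0 k * Q ord0 j = P ord0 j * Q ord0 k -> Q ord0 j = Q ord0 k / P ord0 k * P ord0 j.
  by move=> h; rewrite mulrAC [Q _ _ * _]mulrC -h mulrAC divff // mul1r.
case: k Pk e => -[|[|[|//]]] k3; set k := Ordinal k3 => Pk e.
- have kE : k = o0 by exact: val_inj.
  by apply: row3P; rewrite [RHS]mxE; apply: e; rewrite kE ?h2 -?h1.
- have kE : k = o1 by exact: val_inj.
  by apply: row3P; rewrite [RHS]mxE; apply: e; rewrite kE ?h0 -?h2.
- have kE : k = o2 by exact: val_inj.
  by apply: row3P; rewrite [RHS]mxE; apply: e; rewrite kE ?h1 -?h0.
Qed.

(** Take the line joining [P] to the coordinate point of index [i]: its value at [Q] is the
    coordinate [i] of [cross P Q]. *)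
Lemma cross_sep P Q : cross P Q != 0 -> exists2 c, dot c P = 0 & dot c Q != 0.
Proof.
case/rV0Pn => i; rewrite mxE => PQ.
have [c h1 h2] : exists2 c, dot c P = 0 & dot c Q = (cross P Q) ord0 i.
  case: i PQ => -[|[|[|//]]] i3 _; rewrite mxE /=.
  - exists (cross (\row_j (j == o0)%:R) P); first by rewrite dotE !mxE /=; ring.
    by rewrite dotE !mxE /=; ring.
  - exists (cross (\row_j (j == o1)%:R) P); first by rewrite dotE !mxE /=; ring.
    by rewrite dotE !mxE /=; ring.
  - exists (cross (\row_j (j == o2)%:R) P); first by rewrite dotE !mxE /=; ring.
    by rewrite dotE !mxE /=; ring.
by exists c => //; rewrite h2 mxE.
Qed.

Lemma cross_neq0C P Q : (cross Q P != 0) = (cross P Q != 0).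
Proof.
congr (~~ _); rewrite -[in RHS]oppr_eq0; congr (_ == 0).
by apply: row3P; rewrite !mxE /=; ring.
Qed.
End Vanishing.

(** * Linear conditions imposed by multiplicities *)

Section JetSpaces.
Variables (K : fieldType) (I : finType) (M : I -> 'M[K]_3).
Implicit Types (N : I -> nat) (c : 'rV[K]_3).

(* The coefficient of 'X^k in a jet has degree at most k, hence k.+1 conditions. *)
Definition jet_index N : finType := {i : I & {k : 'I_(N i) & 'I_k.+1}}.

Definition jpt N (x : jet_index N) : I := tag x.
Definition jdeg N (x : jet_index N) : nat := tag (tagged x).
Definition jexp N (x : jet_index N) : nat := tagged (tagged x).

Lemma card_jet_index N : #|{: jet_index N}| = (\sum_i 'C((N i).+1, 2))%N.
Proof.
rewrite card_tagged sumnE big_map big_enum; apply: eq_bigr => i _.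
rewrite card_tagged sumnE big_map big_enum -bin2_sum big_nat_recl // add0n big_mkord.
by apply: eq_bigr => k _; rewrite card_ord.
Qed.

Lemma jet_index_inj N (x y : jet_index N) : jpt x = jpt y ->
  jdeg x = jdeg y -> jexp x = jexp y -> x = y.
Proof.
case: x y => [i [k j]] [i' [k' j']]; rewrite /jpt /jdeg /jexp /= => ii; case: i' / ii k' j' => k' j' /= /val_inj kk.
by case: k' / kk j' => j' /val_inj ->.
Qed.

Section Degree.
Variable n : nat.
Let U := dhomog 3 K n.

Definition jet_row N (f : U) : 'rV[K]_#|{: jet_index N}| :=
  \row_r let x : jet_index N := enum_val r in ((jet (M (jpt x)) f)`_(jdeg x))`_(jexp x).

Lemma jet_row_is_linear N : linear (@jet_row N).
Proof.
move=> a f g; apply/rowP => r; rewrite !mxE /= rmorphD /= jetZ coefD coefCM coefD.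
by rewrite coefCM.
Qed.

HB.instance Definition _ N :=
  GRing.isLinear.Build K U 'rV[K]_#|{: jet_index N}| _ (@jet_row N) (jet_row_is_linear N).

Definition vanishing_space N : {vspace U} := lker (linfun (@jet_row N)).

Lemma vanishing_spaceP N (f : U) :
  f \in vanishing_space N <-> forall i, vanishes (M i) (N i) f.
Proof.
rewrite memv_ker lfunE /=; split=> [/eqP f0 i|fN].
  apply/divides_XnP => k kN; apply/polyP => j; rewrite coef0.
  have [kj|jk] := ltnP k j.
    by rewrite nth_default // (leq_trans (jet_size _ _ _)).
  pose x : jet_index N := Tagged (fun i => {k : 'I_(N i) & 'I_k.+1})
    (Tagged (fun k : 'I_(N i) => 'I_k.+1) (Ordinal (jk : (j < (Ordinal kN).+1)%N))).
  by have /rowP/(_ (enum_rank x)) := f0; rewrite !mxE enum_rankK.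
apply/eqP/rowP => r; rewrite !mxE /=; set x := enum_val r.
have /divides_XnP -> // := fN (jpt x); rewrite ?coef0 //.
exact: ltn_ord.
Qed.

Lemma dim_vanishing_space_ge N :
  (\dim {:U} <= \dim (vanishing_space N) + \sum_i 'C((N i).+1, 2))%N.
Proof.
rewrite -(limg_ker_dim (linfun (@jet_row N)) fullv) capfv leq_add2l -card_jet_index.
by rewrite (leq_trans (dimvS (subvf _))) // dimvf dim_matrix mul1r.
Qed.

Section Interpolation.
Variable N : I -> nat.
Hypothesis Mu : forall i, M i \in unitmx.
Hypothesis sep : forall i l, i != l ->
  exists2 c, dot c (row o0 (M l)) = 0 & dot c (row o0 (M i)) != 0.
Hypothesis Nn : (\sum_i N i <= n)%N.

Definition coordform (i : I) (j : 'I_3) := lin (row j (invmx (M i))^T).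

Lemma jet_coordform i j : jet (M i) (coordform i j) =
  (j == o0)%:R%:P%:P + ((j == o1)%:R%:P + (j == o2)%:R%:P * 'X)%:P * 'X.
Proof.
have dotM k : dot (row j (invmx (M i))^T) (row k (M i)) = (j == k)%:R.
  rewrite [RHS](_ : _ = (M i *m invmx (M i)) k j); last first.
    by rewrite mulmxV // mxE eq_sym.
  by rewrite mxE; apply: eq_bigr => l _; rewrite !mxE mulrC.
by rewrite jet_lin !dotM.
Qed.

(** For each [l != i] take a line through the point [l] that misses the point [i], to the power
    [N l]. *)
Lemma separator i : exists g : {mpoly K[3]},
  [/\ g \is (\sum_(l | l != i) N l)%N.-homog, (jet (M i) g)`_0 != 0 &
      forall l, l != i -> vanishes (M l) (N l) g].
Proof.
have /fin_all_exists [c cP] : forall l, exists c, l != i ->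
    dot c (row o0 (M l)) = 0 /\ dot c (row o0 (M i)) != 0.
  move=> l; have [li|li] := eqVneq l i; first by exists 0.
  by have [|c c1 c2] := @sep i l; rewrite 1?eq_sym //; exists c.
exists (\prod_(l | l != i) lin (c l) ^+ N l); split.
- elim/big_ind2: _ => [|p d q e hp hq|l li]; first exact: dhomog1.
    exact: dhomogM.
  by have := dhomogMn (N l) (lin_homog (c l)); rewrite mul1n.
- rewrite jet_coef0 polyC_eq0 /ev rmorph_prod; apply/prodf_neq0 => l /cP[_ cl].
  by rewrite rmorphXn expf_neq0 //= -/(ev _ _) ev_lin.
move=> l li; rewrite (bigD1 l) //= mulrC; apply: vanishesMl.
have [cl _] := cP l li; elim: (N l) => [|k IHk]; first exact: vanishes0.
by rewrite exprS -add1n; apply: vanishesM => //; apply: vanishes1; rewrite ev_lin.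
Qed.

(** In degree at least the sum of the [N i] the conditions are independent: the family [e] has one
    form per condition, and the jet map is injective on its combinations. *)
Lemma dim_vanishing_space_le :
  (\dim (vanishing_space N) + \sum_i 'C((N i).+1, 2) <= \dim {:U})%N.
Proof.
have /fin_all_exists [G GP] := separator.
pose D i := (\sum_(l | l != i) N l)%N.
have DN i : (D i + N i <= n)%N.
  by apply: leq_trans Nn; rewrite (bigD1 i) //= addnC.
(* In the coordinates of the frame, [G i] times a local monomial of order [k] with slope exponent
   [j]. The form [coordform i o0], whose jet is 1, fills up the degree to [n]. *)
pose e (x : jet_index N) : {mpoly K[3]} :=
  let i := jpt x in let k := jdeg x in let j := jexp x in
  G i * (coordform i o1 ^+ (k - j) * coordform i o2 ^+ j * coordform i o0 ^+ (n - D i - k)).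
have eh x : e x \is n.-homog.
  case: x => i [k j]; rewrite /e /=; have [Gh _ _] := GP i.
  have := DN i; have := ltn_ord k; have := ltn_ord j; rewrite /= ltnS => jk kN Dn.
  have degE : (D i + (1 * (k - j) + 1 * j + 1 * (n - D i - k)))%N = n by lia.
  have h j := lin_homog (row j (invmx (M i))^T).
  have := dhomogM (Gh : G i \is (D i).-homog) (dhomogM (dhomogM (dhomogMn (k - j) (h o1))
    (dhomogMn j (h o2))) (dhomogMn (n - D i - k) (h o0))).
  by rewrite degE.
have jete x : jet (M (jpt x)) (e x) =
    jet (M (jpt x)) (G (jpt x)) * (('X^(jexp x))%:P * 'X^(jdeg x)).
  case: x => i [k j]; rewrite /e /jpt /jdeg /jexp /= rmorphM; congr (_ * _).
  rewrite !rmorphM !rmorphXn /= !jet_coordform /= !polyC0 !mul0r !addr0 !add0r.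
  rewrite !polyC0 mul0r addr0 !polyC1 !mul1r expr1n mulr1 exprMn mulrCA; congr (_ * _).
  by rewrite -exprD subnK // -ltnS.
pose u (v : 'rV[K]_#|{: jet_index N}|) : U :=
  \sum_r v 0 r *: DHomog (eh (enum_val r)).
have ulin : linear u.
  move=> a v w; rewrite /u scaler_sumr -big_split /=; apply: eq_bigr => r _.
  by rewrite !mxE scalerDl scalerA.
pose ul : {linear _ -> _} := HB.pack u (GRing.isLinear.Build _ _ _ _ u ulin).
pose h := (linfun (@jet_row N) \o linfun ul)%VF.
have kerh : (fullv :&: lker h = 0)%VS.
  apply/eqP; rewrite -subv0; apply/subvP => v; rewrite memv_cap memvf memv_ker memv0 /=.
  rewrite comp_lfunE [linfun ul _]lfunE => /= hv.
  have /vanishing_spaceP uv : u v \in vanishing_space N by rewrite memv_ker.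
  apply/eqP/rowP => r0; rewrite mxE; set x0 := enum_val r0; set i := jpt x0.
  pose q := \sum_(r | jpt (enum_val r) == i) (v 0 r)%:P%:P *
    (('X^(jexp (enum_val r)))%:P * 'X^(jdeg (enum_val r))).
  (* At the point [i] the forms attached to other points vanish to order [N i], and the jet of [G i]
     cancels. What remains is a combination of distinct monomials of order below [N i], so its
     coefficients are zero. *)
  have : divides 'X^(N i) q.
    have [_ G0 _] := GP i; apply: (divides_Xn_unit G0).
    have -> : jet (M i) (G i) * q = jet (M i) (u v) -
       \sum_(r | jpt (enum_val r) != i) (v 0 r)%:P%:P * jet (M i) (e (enum_val r)).
      rewrite /u raddf_sum raddf_sum /= (bigID (fun r => jpt (enum_val r) == i)) /=.
      rewrite [X in _ = _ + X - _](eq_bigr (fun r => (v 0 r)%:P%:P * jet (M i) (e (enum_val r)))).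
        rewrite addrK mulr_sumr; apply: eq_bigr => r /eqP <-.
        by rewrite jetZ /= jete mulrCA.
      by move=> r _; rewrite jetZ.
    apply: dividesB; first exact: uv.
    apply: divides_sum => r ri; apply: dividesMl.
    have [_ _ Gl] := GP (jpt (enum_val r)).
    by rewrite /e /= rmorphM; apply: dividesMr; apply: Gl; rewrite eq_sym.
  move/divides_XnP/(_ (jdeg x0) (ltn_ord _)).
  move/(congr1 (fun p : {poly K} => p`_(jexp x0))).
  rewrite coef0 /q !coef_sum (bigD1 r0) //= big1 => [|r /andP[/eqP ri rr]].
    by rewrite !coefCM !coefXn !eqxx !mulr1 coefXn eqxx mulr1 addr0.
  rewrite !coefCM coefXn.
  have [kk|_] := eqVneq; last by rewrite !mulr0 coef0 mulr0.
  rewrite mulr1 coefXn; have [jj|_] := eqVneq; last by rewrite mulr0.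
  case/eqP: rr; apply: enum_val_inj; apply: jet_index_inj => //.
have dimh : \dim (limg h) = (\sum_i 'C((N i).+1, 2))%N.
  by rewrite (limg_dim_eq kerh) dimvf dim_matrix mul1r card_jet_index.
rewrite -(limg_ker_dim (linfun (@jet_row N)) fullv) capfv leq_add2l -dimh.
by rewrite dimvS // limg_comp limgS // subvf.
Qed.
End Interpolation.
End Degree.
End JetSpaces.

(** * Multiplication maps between homogeneous parts *)

Lemma bin2S k : ('C(k.+1, 2) * 2 = k.+1 * k)%N.
Proof. by rewrite [LHS](bin_ffact k.+1 2) ffactnS ffactn1. Qed.

Section HomogeneousMul.
Variable K : fieldType.
Variables n k : nat.
Implicit Types (p : {mpoly K[3]}) (f : dhomog 3 K n).

(** The projection makes this a linear map into degree [k] for any [p]; for [p] homogeneous of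
    degree [k - n] it is the plain product. *)
Definition hmul p f : dhomog 3 K k := DHomog (pihomogP mdeg k (p * f)).

Lemma hmul_is_linear p : linear (hmul p).
Proof.
by move=> a f g; apply: val_inj; rewrite /= mulrDr -scalerAr linearD linearZ.
Qed.

HB.instance Definition _ p :=
  GRing.isLinear.Build K (dhomog 3 K n) (dhomog 3 K k) _ (hmul p) (hmul_is_linear p).

Lemma hmulE p e f : p \is e.-homog -> (e + n)%N = k -> hmul p f = p * f :> {mpoly K[3]}.
Proof.
move=> hp ek; rewrite /= pihomog_dE // -ek.
by apply: dhomogM => //; exact: dhomog_is_dhomog.
Qed.
End HomogeneousMul.

(** * Bezout's inequality with multiplicities *)

Section Bezout.
Variables (K : closedFieldType) (I : finType) (M : I -> 'M[K]_3).
Hypothesis Mu : forall i, M i \in unitmx.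
Hypothesis sep : forall i l, i != l ->
  exists2 c, dot c (row o0 (M l)) = 0 & dot c (row o0 (M i)) != 0.
Variables (D : {mpoly K[3]}) (d : nat) (m : I -> nat).
Hypotheses (D0 : D != 0) (Dh : D \is d.-homog) (Dm : forall i, vanishes (M i) (m i) D).
Variables (F : {poly {mpoly K[3]}}) (e : nat) (a : I -> nat).
Hypotheses (Fh : forall k, F`_k \is e.-homog) (Fa : forall k i, vanishes (M i) (a i) F`_k).
Hypothesis reg : forall g, (forall k, divides D (F`_k * g)) -> divides D g.

(** The padding [s] makes the degree [n] large enough for the multiplicities [a i + m i] to impose
    independent conditions. *)
Let s := (\sum_i (a i + m i))%N.
Let n := (e + (d + s))%N.
Let V := dhomog 3 K (d + s).
Let W := dhomog 3 K (e + s).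
Let mulD : 'Hom(dhomog 3 K s, V) := linfun (hmul (d + s) D).
(** A model of the degree [d + s] part of R / (D). *)
Let C := ((limg mulD)^C)%VS.

Let lin_val (k b : nat) (w : 'I_b -> dhomog 3 K k) (v : 'I_b -> {poly K}) l :
  (\sum_i map_poly (@mpolyC 3 K) (v i) * (val (w i))%:P)`_l
  = val (\sum_i (v i)`_l *: w i).
Proof.
rewrite coef_sum raddf_sum; apply: eq_bigr => i _ /=.
by rewrite coefMC coef_map /= mul_mpolyC.
Qed.

Let vbasis_indep (k : nat) (X : {vspace dhomog 3 K k}) (v : 'I_(\dim X) -> K) :
  \sum_i v i *: (vbasis X)`_i = 0 -> forall i, v i = 0.
Proof.
move=> v0 i; have /freeP := basis_free (vbasisP X); exact.
Qed.

(** The coefficients of [F] are the given forms, and [f] is a value of [F] at a scalar. By McCoy [F]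
    is regular modulo [D], so its products with a basis of [C], together with [D] times a basis of
    [W], are independent over K[t]; [generic_free] keeps this at some t. *)
Lemma generic_member : exists2 f : {mpoly K[3]},
  f \is e.-homog /\ (forall i, vanishes (M i) (a i) f) &
  forall (x : V) (y : W), x \in C -> f * x + D * y = 0 -> x = 0.
Proof.
pose w (i : 'I_(\dim C + \dim {: W})) := match split i with
  | inl i => F * (val (vbasis C)`_i)%:P
  | inr j => (D * val (vbasis {: W})`_j)%:P end.
have wl i : w (lshift _ i) = F * (val (vbasis C)`_i)%:P by rewrite /w (unsplitK (inl _)).
have wr j : w (rshift _ j) = (D * val (vbasis {: W})`_j)%:P by rewrite /w (unsplitK (inr _)).
have [v|t tP] := @generic_free K 3 _ w.
  rewrite big_split_ord /=.
  under eq_bigr do rewrite wl mulrCA.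
  under [X in _ + X]eq_bigr do rewrite wr polyCM mulrCA.
  rewrite -!mulr_sumr; set g := \sum_i _; set h := \sum_i _ => gh.
  have gC k : g`_k = val (\sum_i (v (lshift _ i))`_k *: (vbasis C)`_i).
    exact: lin_val.
  have hW k : h`_k = val (\sum_j (v (rshift _ j))`_k *: (vbasis {: W})`_j).
    exact: lin_val.
  have Dg : divides D%:P g.
    apply: (mccoy reg); exists (- h).
    by apply/eqP; rewrite mulNr -addr_eq0 [h * _]mulrC gh.
  have vC k i : (v (lshift _ i))`_k = 0.
    move: i; apply: (@vbasis_indep _ C) => /=; set x := \sum_i _.
    have xC : x \in C by apply: memv_suml => i _; rewrite memvZ // vbasis_mem ?mem_nth ?size_tuple.
    apply/eqP; rewrite -memv0 -(capv_compl (limg mulD)) memv_cap xC andbT.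
    have [x0|x0] := eqVneq x 0; first by rewrite x0 mem0v.
    have [q qE] := divides_coef k Dg; rewrite gC -/x in qE.
    have q0 : q != 0 by apply: contraNneq x0 => q0; rewrite -val_eqE /= qE q0 mul0r.
    have [|_] := @dhomog_quotient _ _ D q d (d + s) D0 q0 Dh.
      by rewrite mulrC -qE; exact: dhomog_is_dhomog.
    rewrite addKn => qh; have -> : x = mulD (DHomog qh).
      apply: val_inj; rewrite lfunE /= -[LHS]/(val x) qE mulrC pihomog_dE //.
      exact: dhomogM.
    exact: memv_img (memvf _).
  have g0 : g = 0 by apply/polyP => k; rewrite gC coef0 big1 // => i _; rewrite vC scale0r.
  have h0 : h = 0.
    apply/eqP; move/eqP: gh; rewrite g0 mulr0 add0r mulf_eq0 polyC_eq0.
    by rewrite (negPf D0).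
  move=> i; apply/polyP => k; rewrite coef0; case: (split_ordP i) => [j ->|j ->].
    exact: vC.
  move: j; apply: (@vbasis_indep _ {: W}) => /=; apply: val_inj.
  by rewrite -hW h0 coef0.
exists F.[t%:MP].
  split=> [|i]; rewrite horner_coef.
    by apply: rpred_sum => k _; rewrite -rmorphXn /= mulrC mul_mpolyC rpredZ ?Fh.
  rewrite /vanishes raddf_sum; apply: divides_sum => k _ /=.
  by rewrite rmorphM; apply: dividesMr; exact: Fa.
move=> x y xC xy0.
pose c (i : 'I_(\dim C + \dim {: W})) := match split i with
  | inl i => coord (vbasis C) i x
  | inr j => coord (vbasis {: W}) j y end.
have cl i : c (lshift _ i) = coord (vbasis C) i x by rewrite /c (unsplitK (inl _)).
have cr j : c (rshift _ j) = coord (vbasis {: W}) j y by rewrite /c (unsplitK (inr _)).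
rewrite (coord_vbasis xC) big1 // => i _; rewrite -cl tP ?scale0r //.
rewrite big_split_ord /= -[RHS]xy0; congr (_ + _).
  rewrite [in RHS](coord_vbasis xC) raddf_sum mulr_sumr; apply: eq_bigr => j _.
  by rewrite cl wl hornerM hornerC /= scalerAr.
rewrite [in RHS](coord_vbasis (memvf y)) raddf_sum mulr_sumr; apply: eq_bigr => j _.
by rewrite cr wr hornerC /= scalerAr.
Qed.

(** The ideal (f, D) has codimension [e * d] in degree [n]. It lies in [JR] enlarged by the images
    of complements of [JV] and [JW], since [f * JV] and [D * JW] have multiplicities [a i + m i].
    Hence [e * d] is at least the conditions for [a i + m i] minus those for [a i] and for [m i],
    which leaves the sum of the [a i * m i]. *)
Theorem bezout_multiplicities : (\sum_i a i * m i <= e * d)%N.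
Proof.
have [f [fh fa] fP] := generic_member.
pose R := dhomog 3 K n.
pose mf : 'Hom(V, R) := linfun (hmul n f).
pose mD : 'Hom(W, R) := linfun (hmul n D).
have mfE x : mf x = f * x :> {mpoly K[3]} by rewrite lfunE /=; exact: (hmulE _ fh).
have mDE y : mD y = D * y :> {mpoly K[3]}.
  by rewrite lfunE; apply: (hmulE _ Dh); rewrite /n addnCA.
have kerf : (C :&: lker mf = 0)%VS.
  apply/eqP; rewrite -subv0; apply/subvP => x /memv_capP[xC]; rewrite memv_ker memv0 => /eqP fx.
  by apply/eqP/(fP x 0) => //; rewrite mulr0 addr0 -mfE fx.
have kerD (k l : nat) (g : 'Hom(dhomog 3 K k, dhomog 3 K l)) :
    (forall y, g y = D * y :> {mpoly K[3]}) -> (fullv :&: lker g = 0)%VS.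
  move=> gE; apply/eqP; rewrite -subv0; apply/subvP => y /memv_capP[_]; rewrite memv_ker memv0.
  move=> /eqP gy; have := gE y; rewrite gy /= => /esym/eqP; rewrite mulf_eq0 (negPf D0) /=.
  by rewrite -val_eqE.
have disj : ((mf @: C) :&: limg mD = 0)%VS.
  apply/eqP; rewrite -subv0; apply/subvP => z /memv_capP[/memv_imgP[x xC ->] /memv_imgP[y _ xy]].
  rewrite (fP x (- y) xC) ?linear0 ?mem0v //.
  by rewrite raddfN mulrN -mfE xy mDE subrr.
have dimT : \dim (mf @: C + limg mD) = (\dim C + \dim {: W})%N.
  by rewrite dimv_disjoint_sum // !limg_dim_eq // (kerD _ _ mD).
have dimC : (\dim C + \dim {: dhomog 3 K s} = \dim {: V})%N.
  have dimL : \dim (limg mulD) = \dim {: dhomog 3 K s}.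
    by apply/limg_dim_eq/kerD => y; rewrite lfunE; exact: (hmulE _ Dh).
  by rewrite dimv_compl -dimL subnK // dimvS ?subvf.
pose JR := vanishing_space M n (fun i => a i + m i)%N.
pose JV := vanishing_space M (d + s) m.
pose JW := vanishing_space M (e + s) a.
have sub : (mf @: C + limg mD <= JR + (mf @: JV^C + mD @: JW^C))%VS.
  have sub1 : (limg mf <= JR + mf @: JV^C)%VS.
    rewrite -(addv_complf JV) limgD addvS ?subvv //; apply/subvP => z /memv_imgP[x].
    move=> /vanishing_spaceP xV ->; apply/vanishing_spaceP => i; rewrite mfE.
    exact: vanishesM.
  have sub2 : (limg mD <= JR + mD @: JW^C)%VS.
    rewrite -(addv_complf JW) limgD addvS ?subvv //; apply/subvP => z /memv_imgP[x].
    move=> /vanishing_spaceP xV ->; apply/vanishing_spaceP => i; rewrite mDE addnC.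
    exact: vanishesM.
  rewrite subv_add (subv_trans (subv_trans (limgS _ (subvf _)) sub1)) /=; last first.
    by rewrite addvA addvSl.
  by rewrite (subv_trans sub2) // addvS ?subvv ?addvSr.
have := dimvS sub; rewrite dimT.
have := dim_vanishing_space_le Mu sep (leq_trans (leq_addl d s) (leq_addl e _)).
rewrite -/JR -/R -/n => JRle.
have := dim_vanishing_space_ge M (d + s) m; have := dim_vanishing_space_ge M (e + s) a.
rewrite -/JV -/JW -/V -/W => JWge JVge.
have : (\dim (JR + (mf @: JV^C + mD @: JW^C))
    <= \dim JR + (\dim {: V} - \dim JV + (\dim {: W} - \dim JW)))%N.
  apply: leq_trans (dimv_add_leqif _ _).1 _; rewrite leq_add2l.
  apply: leq_trans (dimv_add_leqif _ _).1 _; apply: leq_add.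
    by rewrite -dimv_compl -(limg_ker_dim mf) leq_addl.
  by rewrite -dimv_compl -(limg_ker_dim mD) leq_addl.
have binD : (\sum_i 'C((a i + m i).+1, 2) =
    \sum_i 'C((a i).+1, 2) + \sum_i 'C((m i).+1, 2) + \sum_i a i * m i)%N.
  rewrite -!big_split; apply: eq_bigr => i _ /=.
  have := bin2S (a i); have := bin2S (m i); have := bin2S (a i + m i); nia.
have dimE k : (\dim {: dhomog 3 K k} * 2 = k.+2 * k.+1)%N.
  rewrite dimvf -bin2S -[X in (X * 2)%N]/('C(k + 2, k)) -bin_sub ?leq_addr //.
  by rewrite addKn addn2.
have := dimE s; have := dimE (d + s)%N; have := dimE (e + s)%N; have := dimE n.
rewrite -/V -/W -/R; move: binD dimC JRle JWge JVge; rewrite /n.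
move: (\dim {: R}) (\dim {: V}) (\dim {: W}) (\dim {: dhomog 3 K s}) (\dim JR) => r v w u jr.
move: (\dim JV) (\dim JW) (\dim C) (\dim (JR + _)) => jv jw c x.
move: (\sum_i 'C(_, 2))%N (\sum_i 'C((a i).+1, 2))%N (\sum_i 'C((m i).+1, 2))%N => bn ba bm.
move: (\sum_i a i * m i)%N => am.
(* Twice the identity dim R + dim R_s = dim V + dim W + e d, where R, V, W and R_s are the forms of
   degree n, d + s, e + s and s. *)
have : (((e + (d + s)).+2 * (e + (d + s)).+1 + s.+2 * s.+1) =
  (d + s).+2 * (d + s).+1 + (e + s).+2 * (e + s).+1 + 2 * (e * d))%N by ring.
move: (_.+2 * _.+1)%N (s.+2 * _)%N ((d + s).+2 * _)%N ((e + s).+2 * _)%N (e * d)%N => y1 y2 y3 y4 ed.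
lia.
Qed.
End Bezout.

Definition linear_free (K : fieldType) (D : {mpoly K[3]}) :=
  forall c : 'rV[K]_3, c != 0 -> ~ divides (lin c) D.

(* If the class (e; a) is nef against lines, a linear factor of D can be divided
   out without making e * d - sum a m larger. *)
Theorem bezout_nef (K : closedFieldType) (I : finType) (P : I -> 'rV[K]_3)
    (e : nat) (a : I -> nat) (Fs : seq {mpoly K[3]}) :
    (forall i l, i != l -> cross (P i) (P l) != 0) ->
    (forall i, P i != 0) ->
    (forall f, f \in Fs -> f \is e.-homog) ->
    (forall f i M, f \in Fs -> row o0 M = P i -> vanishes M (a i) f) ->
    (forall c, c != 0 -> (\sum_(i | dot c (P i) == 0%R) a i <= e)%N) ->
    (forall D g, linear_free D -> (forall f, f \in Fs -> divides D (f * g)) ->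
       divides D g) ->
  forall (D : {mpoly K[3]}) (d : nat) (m : I -> nat),
    D != 0 -> D \is d.-homog ->
    (forall i M, row o0 M = P i -> vanishes M (m i) D) ->
  (\sum_i a i * m i <= e * d)%N.
Proof.
move=> PP P0 Fh Fa nef reg D d m D0 Dh Dm; rewrite leqNgt; apply/negP => neg.
have /fin_all_exists2 [M Mu MP] := fun i => frame_exists (P0 i).
have {Dm} : forall i, vanishes (M i) (m i) D by move=> i; apply: Dm.
have [k] := ubnP d; elim: k d D m D0 Dh neg => // k IHk d D m D0 Dh neg dk Dm.
have Dlf : linear_free D.
  move=> c c0 [q DE].
  have q0 : q != 0 by apply: contraNneq D0 => q0; rewrite DE q0 mul0r.
  have [||d1 qh] := @dhomog_quotient _ _ (lin c) q 1 d _ q0 (lin_homog c).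
  - by rewrite lin_eq0.
  - by rewrite mulrC -DE.
  (* Dividing by the line costs one multiplicity at each point on it. *)
  pose m' i := (m i - (dot c (P i) == 0%R))%N.
  apply: (IHk (d - 1)%N q m' q0 qh); last 2 first.
  - by lia.
  - move=> i; rewrite /m' -MP; apply: vanishes_lin_quotient => //.
    by rewrite mulrC -DE.
  (* The weighted sum drops by at most [e], by nefness, while [e * d] drops by exactly [e]: the
     violation persists in smaller degree. *)
  have h : (\sum_i a i * m i <= \sum_i a i * m' i + e)%N.
    apply: leq_trans (leq_add (leqnn _) (nef c c0)).
    rewrite [X in (_ <= _ + X)%N]big_mkcond -big_split leq_sum // => i _ /=.
    by rewrite /m'; case: (dot c (P i) == 0) => /=; nia.
  nia.
suff : (\sum_i a i * m i <= e * d)%N by rewrite leqNgt neg.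
(* [Poly Fs] turns the list of forms into a polynomial in the parameter. *)
apply: (@bezout_multiplicities K I M Mu _ D d m D0 Dh Dm (Poly Fs) e a).
- by move=> i l il; rewrite !MP; apply: cross_sep; apply: PP; rewrite eq_sym.
- move=> j; rewrite coef_Poly; have [sz|sz] := ltnP j (size Fs).
    by apply: Fh; rewrite mem_nth.
  by rewrite nth_default // rpred0.
- move=> j i; rewrite coef_Poly; have [sz|sz] := ltnP j (size Fs).
    by apply: (Fa _ i); rewrite ?mem_nth ?MP.
  by rewrite nth_default // /vanishes rmorph0; exact: divides0.
move=> g gP; apply: reg => // f fF.
by have := gP (index f Fs); rewrite coef_Poly nth_index.
Qed.

(** * Unisolvent point sets and dual bases of forms *)

Section DualForms.
Variables (K : fieldType) (q : nat).
Implicit Types (P : 'rV[K]_3) (h : {mpoly K[3]}).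
Let U := dhomog 3 K q.

Definition unisolvent (r : nat) (P : 'I_r -> 'rV[K]_3) :=
  forall h, h \is q.-homog -> (forall i, ev (P i) h = 0) -> h = 0.

Definition dual_forms (r : nat) (P : 'I_r -> 'rV[K]_3) (S : 'I_r -> {mpoly K[3]}) :=
  [/\ forall i, S i \is q.-homog, forall i j, ev (P j) (S i) = (i == j)%:R
    & forall h, h \is q.-homog -> h = \sum_i ev (P i) h *: S i].

Lemma dim_dhomog3 (k : nat) : \dim {: dhomog 3 K k} = 'C(k.+2, 2).
Proof.
by rewrite dimvf -[LHS]/('C(k + 2, k)) -bin_sub ?leq_addr // addKn addn2.
Qed.

Lemma evD P h1 h2 : ev P (h1 + h2) = ev P h1 + ev P h2.
Proof. exact: mevalD. Qed.

Lemma evM P h1 h2 : ev P (h1 * h2) = ev P h1 * ev P h2.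
Proof. exact: mevalM. Qed.

Lemma evZ P a h : ev P (a *: h) = a * ev P h.
Proof. exact: mevalZ. Qed.

Lemma ev_sum P (J : Type) (r : seq J) (Q : pred J) (G : J -> {mpoly K[3]}) :
  ev P (\sum_(j <- r | Q j) G j) = \sum_(j <- r | Q j) ev P (G j).
Proof. exact: (raddf_sum (meval (fun i => P ord0 i))). Qed.

Let b (k : 'I_(\dim {: U})) : {mpoly K[3]} := val (vbasis {: U})`_k.

Let bE h (hh : h \is q.-homog) : h = \sum_k coord (vbasis {: U}) k (DHomog hh) *: b k.
Proof.
by have /(congr1 val) := coord_vbasis (memvf (DHomog hh)); rewrite raddf_sum.
Qed.

Let bh k : b k \is q.-homog. Proof. exact: dhomog_is_dhomog. Qed.

(** The evaluation matrix is square with trivial kernel; the columns of its inverse give the dual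
    forms. *)
Lemma unisolvent_dual (r : nat) (P : 'I_r -> 'rV[K]_3) : r = 'C(q.+2, 2) ->
  unisolvent P -> exists S, dual_forms P S.
Proof.
rewrite -dim_dhomog3 => rE; subst r => PU; pose B := \matrix_(j, k) ev (P j) (b k).
have Bu : B \in unitmx.
  rewrite -unitmx_tr -row_free_unit; apply: inj_row_free => v vB.
  have v0 : \sum_k v 0 k *: b k = 0.
    apply: PU => [|j]; first by apply: rpred_sum => k _; rewrite rpredZ ?bh.
    have := congr1 (fun A : 'rV_(_) => A 0 j) vB; rewrite !mxE => <-.
    by rewrite ev_sum; apply: eq_bigr => k _; rewrite evZ !mxE.
  apply/rowP => k; rewrite mxE; have /freeP := basis_free (vbasisP {: U}); apply.
  by apply: val_inj; rewrite raddf_sum.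
pose S i := \sum_k invmx B k i *: b k.
have Sh i : S i \is q.-homog by apply: rpred_sum => k _; rewrite rpredZ ?bh.
have SP i j : ev (P j) (S i) = (i == j)%:R.
  rewrite eq_sym; have /matrixP/(_ j i) := mulmxV Bu; rewrite !mxE => <-.
  by rewrite ev_sum; apply: eq_bigr => k _; rewrite evZ mxE mulrC.
exists S; split=> // h hh; apply/eqP; rewrite -subr_eq0; apply/eqP; apply: PU.
  by rewrite rpredB //; apply: rpred_sum => i _; rewrite rpredZ ?Sh.
move=> j; rewrite -scaleN1r evD evZ ev_sum (bigD1 j) //= big1 => [|i /negPf ij].
  by rewrite evZ SP eqxx mulr1 addr0 mulN1r subrr.
by rewrite evZ SP ij mulr0.
Qed.

(** Evaluation on all of [Z] has full column rank, so an invertible square submatrix can be selected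
    among its rows. *)
Lemma unisolvent_exists (r : nat) (Z : seq 'rV[K]_3) : r = 'C(q.+2, 2) ->
    (forall h, h \is q.-homog -> (forall P, P \in Z -> ev P h = 0) -> h = 0) ->
  exists2 P : 'I_r -> 'rV[K]_3, forall i, P i \in Z & unisolvent P.
Proof.
rewrite -dim_dhomog3 => rE; subst r => ZU; pose B := \matrix_(l < size Z, k < \dim {: U}) ev Z`_l (b k).
have Bf : row_full B.
  rewrite /row_full -mxrank_tr; apply: inj_row_free => v vB.
  have v0 : \sum_k v 0 k *: b k = 0.
    apply: ZU => [|P PZ]; first by apply: rpred_sum => k _; rewrite rpredZ ?bh.
    have lt := PZ; rewrite -index_mem in lt.
    have := congr1 (fun A : 'rV_(_) => A 0 (Ordinal lt)) vB; rewrite !mxE => <-.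
    by rewrite ev_sum; apply: eq_bigr => k _; rewrite evZ !mxE /= nth_index.
  apply/rowP => k; rewrite mxE; have /freeP := basis_free (vbasisP {: U}); apply.
  by apply: val_inj; rewrite raddf_sum.
exists (fun i => Z`_(fullrankfun Bf i)); first by move=> i; rewrite mem_nth.
move=> h hh h0; rewrite (bE hh) big1 // => k _.
have Bu := fullrowsub_unit Bf; set B' := rowsub _ _ in Bu.
have c0 : B' *m (\col_k coord (vbasis {: U}) k (DHomog hh)) = 0.
  apply/colP => i; rewrite !mxE -[RHS](h0 i) [in RHS](bE hh) ev_sum.
  by apply: eq_bigr => l _; rewrite !mxE evZ mulrC.
have /colP/(_ k) : \col_k coord (vbasis {: U}) k (DHomog hh) = 0.
  by rewrite -(mulKmx Bu (\col__ _)) c0 mulmx0.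
by rewrite !mxE => ->; rewrite scale0r.
Qed.

(** If [P l] were a multiple of [P i], the dual form of [l], zero at [P i], would also be zero at
    [P l]. *)
Lemma unisolvent_cross (r : nat) (P : 'I_r -> 'rV[K]_3) : r = 'C(q.+2, 2) ->
  unisolvent P -> (forall i, P i != 0) -> forall i l, i != l -> cross (P i) (P l) != 0.
Proof.
move=> rE /(unisolvent_dual rE) [S [Sh SP _]] P0 i l il.
apply/eqP => /(cross_eq0 (P0 i)) [a Pl]; have := SP l l.
by rewrite Pl (ev_homogZ _ _ (Sh l)) SP eq_sym (negPf il) mulr0 eqxx => /eqP; rewrite eq_sym oner_eq0.
Qed.
End DualForms.

(* The forms of degree q.+1 that contain a given line have codimension q.+2. *)
Lemma unisolvent_line (K : fieldType) (q r : nat)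
    (P : 'I_r -> 'rV[K]_3) (c : 'rV[K]_3) : r = 'C(q.+3, 2) ->
  unisolvent q.+1 P -> c != 0 -> (\sum_(i | dot c (P i) == 0%R) 1 <= q.+2)%N.
Proof.
rewrite -(dim_dhomog3 K) => rE; subst r => PU c0; pose X := [pred i | dot c (P i) != 0%R].
(* A multiple of the line is determined by its values at the points [X] off the line, so there are
   at least as many of these as the dimension of the forms of degree [q]. *)
pose g (h : dhomog 3 K q) : 'rV[K]_#|X| := \row_x ev (P (enum_val x)) (lin c * h).
have glin : linear g.
  by move=> a h1 h2; apply/rowP => x; rewrite !mxE mulrDr evD -scalerAr evZ.
pose gl : {linear _ -> _} := HB.pack g (GRing.isLinear.Build _ _ _ _ g glin).
have kerg : (fullv :&: lker (linfun gl) = 0)%VS.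
  apply/eqP; rewrite -subv0; apply/subvP => h; rewrite memv_cap memvf memv_ker memv0.
  rewrite [linfun gl h]lfunE => /= /eqP/rowP gh.
  have : lin c * h = 0.
    apply: PU => [|i].
      exact: (@dhomogM _ _ mdeg 1 _ q _ (lin_homog c) (dhomog_is_dhomog h)).
    have [ci|ci] := eqVneq (dot c (P i)) 0; first by rewrite evM ev_lin ci mul0r.
    have iX : i \in X by [].
    by have := gh (enum_rank_in iX i); rewrite !mxE enum_rankK_in.
  by move=> /eqP; rewrite mulf_eq0 lin_eq0 (negPf c0) -val_eqE.
have : (\dim {: dhomog 3 K q} <= #|X|)%N.
  rewrite -(limg_dim_eq kerg); apply: leq_trans (dimvS (subvf _)) _.
  by rewrite dimvf dim_matrix mul1r.
have : (\sum_(i | dot c (P i) == 0%R) 1 + #|X| = \dim {: dhomog 3 K q.+1})%N.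
  rewrite sum1_card -[RHS]card_ord -(cardC X) addnC; congr (_ + _)%N.
  by apply: eq_card => i; rewrite !inE negbK.
have := dim_dhomog3 K q; have := dim_dhomog3 K q.+1.
have := bin2S q.+1; have := bin2S q.+2.
set x := (\sum_(i | dot c (P i) == 0%R) 1)%N; set y := #|X|; move: x y => x y.
by clear; move: (\dim _) (\dim _) => d1 d2; nia.
Qed.

Lemma line_through (K : fieldType) (P : 'rV[K]_3) : P != 0 ->
  exists2 c, c != 0 & dot c P = 0.
Proof.
move=> /frame_exists [M Mu <-]; have dotM k :
    dot (row o1 (invmx M)^T) (row k M) = (o1 == k)%:R.
  rewrite [RHS](_ : _ = (M *m invmx M) k o1); last by rewrite mulmxV // mxE eq_sym.
  by rewrite mxE; apply: eq_bigr => l _; rewrite !mxE mulrC.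
exists (row o1 (invmx M)^T); last by rewrite dotM.
apply/eqP => c0; have := dotM o1; rewrite c0 /dot big1 => [/esym/eqP|l _].
  by rewrite oner_eq0.
by rewrite mxE mul0r.
Qed.

(* Chudnovsky's bound for the initial degree of the m-th symbolic power. *)
Theorem chudnovsky (K : closedFieldType) (q d m : nat)
    (P : 'I_('C(q.+3, 2)) -> 'rV[K]_3) (D : {mpoly K[3]}) :
    unisolvent q.+1 P -> (forall i, P i != 0) ->
    D != 0 -> D \is d.-homog -> (forall i M, row o0 M = P i -> vanishes M m D) ->
  ('C(q.+3, 2) * m <= q.+2 * d)%N.
Proof.
move=> PU P0 D0 Dh Dm; have [S [Sh SP Sspan]] := unisolvent_dual (erefl _) PU.
have /fin_all_exists2 [c c0 cP] : forall i, exists2 c, c != 0 & dot c (P i) = 0.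
  by move=> i; exact: line_through.
have <- : (\sum_(i < 'C(q.+3, 2)) 1 * m = 'C(q.+3, 2) * m)%N.
  by rewrite sum_nat_const card_ord mul1n.
(* The member of index [i] vanishes at [P i] through its line and at the other points through
   [S i]. *)
apply: (@bezout_nef K _ P q.+2 (fun=> 1%N) [seq lin (c i) * S i | i <- enum 'I__]
  (unisolvent_cross (erefl _) PU P0) P0 _ _ _ _ D d (fun=> m) D0 Dh Dm).
- by move=> f /mapP[i _ ->]; exact: (@dhomogM _ _ mdeg 1 _ q.+1 _ (lin_homog _) (Sh i)).
- move=> f i M /mapP[j _ ->] MP; apply: vanishes1; rewrite MP evM ev_lin SP.
  by have [->|_] := eqVneq j i; rewrite ?cP ?mul0r ?mulr0.
- by move=> v v0; exact: (unisolvent_line (erefl _)).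
move=> D' g lf gP.
(* Cancelling the lines leaves the [S i], which span degree [q.+1]. That span contains a power of a
   coordinate, which cancels as well. *)
have gS i : divides D' (S i * g).
  apply: (lin_cancel (c0 i) (lf _ (c0 i))); rewrite mulrA; apply: gP.
  by apply: map_f; rewrite mem_enum.
have gh h : h \is q.+1.-homog -> divides D' (h * g).
  move=> /Sspan ->; rewrite mulr_suml; apply: divides_sum => i _.
  by rewrite -mul_mpolyC -mulrA; apply: dividesMl.
have e0 : delta_mx ord0 o0 != 0 :> 'rV[K]_3.
  by apply/eqP => /rowP/(_ o0)/eqP; rewrite !mxE eqxx oner_eq0.
have : divides D' (lin (delta_mx ord0 o0) ^+ q.+1 * g).
  by apply: gh; have := dhomogMn q.+1 (lin_homog (delta_mx ord0 o0 : 'rV[K]_3)); rewrite mul1n.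
elim: q.+1 => [|k IHk]; first by rewrite mul1r.
by rewrite exprS -mulrA => /(lin_cancel e0 (lf _ e0)).
Qed.

(** * Six points on no conic, and quartics with three double points *)

Definition i0 : 'I_6 := @Ordinal 6 0 isT.
Definition i1 : 'I_6 := @Ordinal 6 1 isT.
Definition i2 : 'I_6 := @Ordinal 6 2 isT.
Definition i3 : 'I_6 := @Ordinal 6 3 isT.
Definition i4 : 'I_6 := @Ordinal 6 4 isT.
Definition i5 : 'I_6 := @Ordinal 6 5 isT.

Lemma ord6P (Q : 'I_6 -> Prop) :
  Q i0 -> Q i1 -> Q i2 -> Q i3 -> Q i4 -> Q i5 -> forall i, Q i.
Proof.
move=> h0 h1 h2 h3 h4 h5 [[|[|[|[|[|[|//]]]]]] lt].
- by rewrite (_ : Ordinal lt = i0) //; exact: val_inj.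
- by rewrite (_ : Ordinal lt = i1) //; exact: val_inj.
- by rewrite (_ : Ordinal lt = i2) //; exact: val_inj.
- by rewrite (_ : Ordinal lt = i3) //; exact: val_inj.
- by rewrite (_ : Ordinal lt = i4) //; exact: val_inj.
- by rewrite (_ : Ordinal lt = i5) //; exact: val_inj.
Qed.

Lemma sum6 (V : nmodType) (G : 'I_6 -> V) :
  \sum_i G i = G i0 + (G i1 + (G i2 + (G i3 + (G i4 + G i5)))).
Proof.
rewrite !big_ord_recl big_ord0 addr0.
by do ?congr (_ + _); congr (G _); exact: val_inj.
Qed.

Lemma sum6n (G : 'I_6 -> nat) :
  (\sum_i G i = G i0 + (G i1 + (G i2 + (G i3 + (G i4 + G i5)))))%N.
Proof.
rewrite !big_ord_recl big_ord0 addn0.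
by do ?congr (_ + _)%N; congr (G _); exact: val_inj.
Qed.

Section Sextuple.
Variable K : closedFieldType.
Implicit Types (P : 'I_6 -> 'rV[K]_3) (D : {mpoly K[3]}).

Lemma dot_crossl (Q X : 'rV[K]_3) : dot (cross Q X) Q = 0.
Proof. by rewrite [LHS]det3E; ring. Qed.

Lemma dot_crossr (Q X : 'rV[K]_3) : dot (cross Q X) X = 0.
Proof. by rewrite [LHS]det3E; ring. Qed.

(** A line through two of the double points meets no third point and weighs 2 + 2; any other line
    weighs at most 2 + 1 + 1. *)
Lemma triple_weight (x : 'I_6 -> bool) : (\sum_(i | x i) 1 <= 3)%N ->
    (forall i j k : 'I_6, (i < 3)%N -> (j < 3)%N -> i != j -> k != i -> k != j ->
       ~~ [&& x i, x j & x k]) ->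
  (\sum_(i < 6 | x i) (i < 3).+1 <= 4)%N.
Proof.
move=> card_x h; rewrite big_mkcond sum6n in card_x; rewrite big_mkcond sum6n.
move: (h i0 i1 i2 isT isT isT isT isT) (h i0 i1 i3 isT isT isT isT isT).
move: (h i0 i1 i4 isT isT isT isT isT) (h i0 i1 i5 isT isT isT isT isT).
move: (h i0 i2 i3 isT isT isT isT isT) (h i0 i2 i4 isT isT isT isT isT).
move: (h i0 i2 i5 isT isT isT isT isT) (h i1 i2 i3 isT isT isT isT isT).
move: (h i1 i2 i4 isT isT isT isT isT) (h i1 i2 i5 isT isT isT isT isT).
move: card_x; clear h; move: (x i0) (x i1) (x i2) (x i3) (x i4) (x i5).
by do 6 case; vm_compute => *; congruence.
Qed.

(* The quartics with double points at P 0, P 1, P 2 and passing through the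
   other three points form a nef system. *)
Theorem good_triple_bound P D (d m : nat) :
    unisolvent 2 P -> (forall i, P i != 0) ->
    (forall i j k : 'I_6, (i < 3)%N -> (j < 3)%N -> i != j -> k != i -> k != j ->
       det3 (P i) (P j) (P k) != 0) ->
    D != 0 -> D \is d.-homog -> (forall i M, row o0 M = P i -> vanishes M m D) ->
  (9 * m <= 4 * d)%N.
Proof.
move=> PU P0 good D0 Dh Dm; have six : 6 = 'C(4, 2) by [].
have [S [Sh SP Sspan]] := unisolvent_dual six PU.
have PP := unisolvent_cross six PU P0.
pose a (i : 'I_6) := (i < 3)%N.+1.
have <- : (\sum_i a i * m = 9 * m)%N by rewrite sum6n /a /=; lia.
(* [S s] is the conic through the five points other than [P s]. The two lines add a second branch at
   the three double points, and the first one restores the passage through [P s]. *)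
pose F s := lin (cross (P s) (P i0)) * (lin (cross (P i1) (P i2)) * S s).
apply: (@bezout_nef K _ P 4 a [:: F i3; F i4; F i5] PP P0 _ _ _ _ D d (fun=> m) D0 Dh Dm).
- move=> f fF; have [s ->] : exists s, f = F s.
    by move: fF; rewrite !inE => /or3P[]/eqP ->; eexists.
  exact: (@dhomogM _ _ mdeg 1 _ 3 _ (lin_homog _)
            (@dhomogM _ _ mdeg 1 _ 2 _ (lin_homog _) (Sh s))).
- move=> f i M fF MP; have [s s3 ->] : exists2 s : 'I_6, (3 <= s)%N & f = F s.
    by move: fF; rewrite !inE => /or3P[]/eqP ->; [exists i3 | exists i4 | exists i5].
  have vlin Q X : dot (cross Q X) (P i) = 0 -> vanishes M 1 (lin (cross Q X)).
    by move=> h; apply: vanishes1; rewrite ev_lin MP.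
  have vS : i != s -> vanishes M 1 (S s).
    by move=> si; apply: vanishes1; rewrite MP SP eq_sym (negPf si).
  have [i_eq|is_] := eqVneq i s.
    rewrite /a i_eq ltnNge s3; apply: (@vanishes_leq _ _ _ (1 + 0)) => //.
    apply: vanishesM; last exact: vanishes0.
    by apply: vlin; rewrite i_eq dot_crossl.
  have {}vS := vS is_.
  rewrite /a; case: ltnP => i3_; last first.
    by rewrite /F mulrA; apply: vanishesMl.
  have [i_eq|i_neq] := eqVneq i i0.
    apply: (@vanishesM _ _ 1 1); first by apply: vlin; rewrite i_eq dot_crossr.
    exact: vanishesMl.
  apply: vanishesMl; apply: (@vanishesM _ _ 1 1) => //; apply: vlin.
  case: i i3_ {MP vS is_} i_neq => [[|[|[|//]]] lt] //= _ _.
    by rewrite (_ : Ordinal lt = i1) ?dot_crossl //; exact: val_inj.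
  by rewrite (_ : Ordinal lt = i2) ?dot_crossr //; exact: val_inj.
- move=> c c0; apply: triple_weight; first exact: (unisolvent_line six).
  move=> i j k hi hj ij ki kj; apply/negP => /and3P[/eqP ci /eqP cj /eqP ck].
  by case/eqP: (good i j k hi hj ij ki kj); exact: (det3_lin c0).
move=> D' g lf gF.
have cancel i j h : i != j -> divides D' (lin (cross (P i) (P j)) * h) -> divides D' h.
  by move=> ij; apply: lin_cancel (PP _ _ ij) (lf _ (PP _ _ ij)).
have gS s : s != i0 -> F s \in [:: F i3; F i4; F i5] -> divides D' (S s * g).
  move=> s0 sF; apply: (@cancel i1 i2) => //; apply: (@cancel s i0) => //.
  by rewrite !mulrA -[X in X * g]mulrA; apply: gF.
apply: (@cancel i0 i1) => //; apply: (@cancel i0 i2) => //.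
(* This pair of lines contains the three double points, so it is a combination of the last three
   dual conics only. *)
pose h := lin (cross (P i0) (P i2)) * lin (cross (P i0) (P i1)).
have hE := Sspan h (@dhomogM _ _ mdeg 1 _ 1 _ (lin_homog _) (lin_homog _)).
rewrite mulrA -/h hE sum6 !evM !ev_lin dot_crossl !mul0r.
rewrite !dot_crossr !(mul0r, mulr0, scale0r, add0r) !mulrDl.
by do ?apply: dividesD; rewrite -mul_mpolyC -mulrA; apply/dividesMl/gS => //;
  rewrite !inE eqxx ?orbT.
Qed.
End Sextuple.

Lemma sum_option (T : finType) (G : option T -> nat) :
  (\sum_o G o = G None + \sum_i G (Some i))%N.
Proof.
rewrite (bigD1 None) //=; congr (_ + _)%N.
rewrite (reindex_omap Some id) /=; last by case.
by apply: eq_bigl => i; rewrite eqxx.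
Qed.

(** * Complete quadrilaterals *)

Section Star.
Variable K : closedFieldType.
Implicit Types (A B C X Y Z Q : 'rV[K]_3).

Definition col A B C := det3 A B C == 0.

Lemma colC A B C : col B A C = col A B C.
Proof. by rewrite /col det3C oppr_eq0. Qed.

Lemma col_rot A B C : col B C A = col A B C.
Proof. by rewrite /col det3_rot. Qed.

Lemma col_lin c A B C : c != 0 -> dot c A == 0 -> dot c B == 0 -> dot c C == 0 -> col A B C.
Proof. by move=> c0 /eqP cA /eqP cB /eqP cC; apply/eqP/(det3_lin c0). Qed.

Ltac csym := solve [ assumption | rewrite colC; assumption | rewrite col_rot; assumption
  | rewrite -col_rot; assumption | rewrite colC col_rot; assumption
  | rewrite colC -col_rot; assumption ].

Ltac ncol h := solve [ by rewrite h | by rewrite colC h | by rewrite col_rot h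
  | by rewrite -col_rot h | by rewrite colC col_rot h | by rewrite colC -col_rot h ].

Lemma col_trans A B C Q : cross B C != 0 -> col A B C -> col B C Q -> col A B Q.
Proof.
move=> BC cA cQ; apply: (col_lin BC) => //; last by rewrite dot_crossl.
by rewrite -[_ == _]/(col B C A); csym.
Qed.

Variables (pts : seq 'rV[K]_3) (D : {mpoly K[3]}).
Hypothesis pts_neq0 : forall Q, Q \in pts -> Q != 0.
Hypotheses (D0 : D != 0) (Dh : D \is 11.-homog).
Hypothesis D5 : forall Q M, Q \in pts -> row o0 M = Q -> vanishes M 5 D.

Definition tuple6 A B C X Y Z (i : 'I_6) : 'rV[K]_3 := [:: A; B; C; X; Y; Z]`_i.

Definition sextet A B C X Y Z :=
  {subset [:: A; B; C; X; Y; Z] <= pts} /\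
  (forall h : {mpoly K[3]}, h \is 2.-homog ->
     (forall Q, Q \in [:: A; B; C; X; Y; Z] -> ev Q h = 0) -> h = 0).

Lemma sextet_reorder A B C X Y Z A' B' C' X' Y' Z' : sextet A B C X Y Z ->
  [:: A; B; C; X; Y; Z] =i [:: A'; B'; C'; X'; Y'; Z'] -> sextet A' B' C' X' Y' Z'.
Proof.
move=> [sub conic] eqs; split=> [Q|h hh h0]; first by rewrite -eqs; exact: sub.
by apply: conic => // Q; rewrite eqs; exact: h0.
Qed.

Ltac reorder S := apply: (sextet_reorder S);
  let Q := fresh in move=> Q; rewrite !inE; do 6 case: (Q == _) => //.

Lemma sextet_unisolvent A B C X Y Z : sextet A B C X Y Z ->
  unisolvent 2 (tuple6 A B C X Y Z).
Proof.
move=> [_ conic] h hh h0; apply: conic => // Q.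
rewrite !inE => /or4P[| | |/or3P[]] /eqP ->.
- exact: h0 i0.
- exact: h0 i1.
- exact: h0 i2.
- exact: h0 i3.
- exact: h0 i4.
- exact: h0 i5.
Qed.

Lemma sextet_pts A B C X Y Z i : sextet A B C X Y Z -> tuple6 A B C X Y Z i \in pts.
Proof. by move=> [sub _]; apply: sub; rewrite mem_nth. Qed.

Lemma sextet_cross A B C X Y Z : sextet A B C X Y Z -> cross A B != 0.
Proof.
move=> S; apply: (unisolvent_cross _ (sextet_unisolvent S) _ (i := i0) (l := i1)) => //.
by move=> i; apply/pts_neq0/sextet_pts.
Qed.

(** Otherwise [A], [B], [C] could serve as double points in [good_triple_bound], giving 45 <= 44. *)
Lemma sextet_bad_triple A B C X Y Z : sextet A B C X Y Z ->
  [\/ col A B C, [\/ col A B X, col A B Y | col A B Z],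
      [\/ col A C X, col A C Y | col A C Z] | [\/ col B C X, col B C Y | col B C Z]].
Proof.
move=> S; have := @good_triple_bound K (tuple6 A B C X Y Z) D 11 5 (sextet_unisolvent S).
case h0 : (col A B C); first by constructor 1.
case h1 : (col A B X); first by constructor 2; constructor 1.
case h2 : (col A B Y); first by constructor 2; constructor 2.
case h3 : (col A B Z); first by constructor 2; constructor 3.
case h4 : (col A C X); first by constructor 3; constructor 1.
case h5 : (col A C Y); first by constructor 3; constructor 2.
case h6 : (col A C Z); first by constructor 3; constructor 3.
case h7 : (col B C X); first by constructor 4; constructor 1.
case h8 : (col B C Y); first by constructor 4; constructor 2.
case h9 : (col B C Z); first by constructor 4; constructor 3.
move=> bound; suff: (9 * 5 <= 4 * 11)%N by [].
apply: bound => //; last by move=> i M; apply/D5/sextet_pts.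
  by move=> i; apply/pts_neq0/sextet_pts.
apply: ord6P; apply: ord6P; apply: ord6P => //= _ _ _ _ _;
  rewrite -[_ == 0]/(col _ _ _) /tuple6 /=;
  first [ncol h0 | ncol h1 | ncol h2 | ncol h3 | ncol h4 | ncol h5 | ncol h6
    | ncol h7 | ncol h8 | ncol h9].
Qed.

(** Two lines form a conic. This will exclude four collinear points and two disjoint collinear
    triples. *)
Lemma lines_conic A B C X Y Z A' B' : sextet A B C X Y Z ->
    cross A B != 0 -> cross A' B' != 0 ->
    (forall Q, Q \in [:: A; B; C; X; Y; Z] -> col A B Q || col A' B' Q) -> False.
Proof.
move=> [_ conic] AB AB' cover.
have /eqP : lin (cross A B) * lin (cross A' B') = 0.
  apply: conic => [|Q /cover].
    exact: (@dhomogM _ _ mdeg 1 _ 1 _ (lin_homog _) (lin_homog _)).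
  by rewrite evM !ev_lin -mulf_eq0 => /eqP.
by rewrite mulf_eq0 !lin_eq0 (negPf AB) (negPf AB').
Qed.

Lemma col_id A B : col A A B. Proof. by rewrite /col det3_id. Qed.
Lemma col_idl A B : col A B A. Proof. by rewrite -col_rot -col_rot col_id. Qed.
Lemma col_idr A B : col A B B. Proof. by rewrite -col_rot col_id. Qed.

Lemma sextet_4col A B C X Y Z : sextet A B C X Y Z -> col A B C -> col A B X -> False.
Proof.
move=> S hC hX; have SYZ : sextet Y Z A B C X by reorder S.
apply: (lines_conic S (sextet_cross S) (sextet_cross SYZ)) => Q.
by rewrite !inE => /or4P[| | |/or3P[]] /eqP ->; rewrite ?col_idl ?col_idr ?hC ?hX ?orbT.
Qed.

Lemma sextet_disjoint A B C X Y Z : sextet A B C X Y Z -> col A B C -> col X Y Z -> False.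
Proof.
move=> S hC hZ; have SXY : sextet X Y A B C Z by reorder S.
apply: (lines_conic S (sextet_cross S) (sextet_cross SXY)) => Q.
by rewrite !inE => /or4P[| | |/or3P[]] /eqP ->; rewrite ?col_idl ?col_idr ?hC ?hZ ?orbT.
Qed.

Ltac clash S a b c x y z := exfalso; apply: (@sextet_4col a b c x y z);
  [reorder S | csym | csym].

(** The six vertices of a complete quadrilateral with sides ABC, AXY, BXZ and CYZ; each vertex is on
    two sides. *)
Definition star A B C X Y Z :=
  [/\ sextet A B C X Y Z, col A B C, col A X Y, col B X Z & col C Y Z].

(** Test the triple C, Y, Z: any bad line other than CYZ itself would contain four of the points. *)
Lemma star_of_3lines A B C X Y Z : sextet A B C X Y Z ->
  col A B C -> col A X Y -> col B X Z -> star A B C X Y Z.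
Proof.
move=> S h1 h2 h3; split=> //.
have S' : sextet C Y Z A B X by reorder S.
case: (sextet_bad_triple S') => [//|[]h|[]h|[]h].
- clash S A C B Y X Z.
- clash S B C A Y X Z.
- clash S X Y A C B Z.
- clash S A C B Z X Y.
- clash S B C A Z X Y.
- clash S X Z B C A Y.
- clash S A Y X Z B C.
- clash S B Z X Y A C.
- clash S X Y A Z B C.
Qed.

(** Test the triple B, X, Z: barring four collinear points, the bad line is BXZ, BYZ or CXZ, a third
    side through Z. *)
Lemma star_of_2lines A B C X Y Z : sextet A B C X Y Z ->
  col A B C -> col A X Y -> exists A' B' C' X' Y' Z', star A' B' C' X' Y' Z'.
Proof.
move=> S h1 h2; have S' : sextet B X Z A C Y by reorder S.
case: (sextet_bad_triple S') => [h|[]h|[]h|[]h].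
- by exists A, B, C, X, Y, Z; apply: star_of_3lines.
- clash S A B C X Y Z.
- clash S B C A X Y Z.
- clash S X Y A B C Z.
- clash S A B C Z X Y.
- clash S B C A Z X Y.
- exists A, B, C, Y, X, Z; apply: star_of_3lines; [reorder S | csym.. ].
- clash S A X Y Z B C.
- exists A, C, B, X, Y, Z; apply: star_of_3lines; [reorder S | csym.. ].
- clash S X Y A Z B C.
Qed.

(** Test the triple X, Y, Z: it is not collinear, so a line through two of its points meets A, B or
    C. *)
Lemma star_of_line A B C X Y Z : sextet A B C X Y Z ->
  col A B C -> exists A' B' C' X' Y' Z', star A' B' C' X' Y' Z'.
Proof.
move=> S h1; have S' : sextet X Y Z A B C by reorder S.
case: (sextet_bad_triple S') => [h|[]h|[]h|[]h].
- by case: (sextet_disjoint S).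
- apply: (@star_of_2lines A B C X Y Z); [reorder S | csym.. ].
- apply: (@star_of_2lines B A C X Y Z); [reorder S | csym.. ].
- apply: (@star_of_2lines C A B X Y Z); [reorder S | csym.. ].
- apply: (@star_of_2lines A B C X Z Y); [reorder S | csym.. ].
- apply: (@star_of_2lines B A C X Z Y); [reorder S | csym.. ].
- apply: (@star_of_2lines C A B X Z Y); [reorder S | csym.. ].
- apply: (@star_of_2lines A B C Y Z X); [reorder S | csym.. ].
- apply: (@star_of_2lines B A C Y Z X); [reorder S | csym.. ].
- apply: (@star_of_2lines C A B Y Z X); [reorder S | csym.. ].
Qed.

Lemma star_exists A B C X Y Z : sextet A B C X Y Z ->
  exists A' B' C' X' Y' Z', star A' B' C' X' Y' Z'.
Proof.
move=> S; case: (sextet_bad_triple S) => [h|[]h|[]h|[]h].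
- exact: (star_of_line S).
- apply: (@star_of_line A B X C Y Z); [reorder S | csym].
- apply: (@star_of_line A B Y C X Z); [reorder S | csym].
- apply: (@star_of_line A B Z C X Y); [reorder S | csym].
- apply: (@star_of_line A C X B Y Z); [reorder S | csym].
- apply: (@star_of_line A C Y B X Z); [reorder S | csym].
- apply: (@star_of_line A C Z B X Y); [reorder S | csym].
- apply: (@star_of_line B C X A Y Z); [reorder S | csym].
- apply: (@star_of_line B C Y A X Z); [reorder S | csym].
- apply: (@star_of_line B C Z A X Y); [reorder S | csym].
Qed.

(** If [Q] were on the side ABC only, it could replace [A]: the other five points lie on a single
    conic, BX with CY, which misses [Q]. In the new sextet the triple Q, X, Y would have no bad
    line. *)
Lemma star_on_line A B C X Y Z Q : star A B C X Y Z -> Q \in pts ->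
  col A B Q -> [|| col A X Q, col B X Q | col C Y Q].
Proof.
move=> [S h1 h2 h3 h4] Qpts hQ; apply/norP => -[nAX /norP[nBX nCY]].
have SBC : sextet B C A X Y Z by reorder S.
have SXY : sextet X Y A B C Z by reorder S.
have SBX : sextet B X A C Y Z by reorder S.
have SCY : sextet C Y A B X Z by reorder S.
have nBXA : ~~ col B X A by apply/negP => h; clash S A B C X Y Z.
have nCYA : ~~ col C Y A by apply/negP => h; clash S A Y X C B Z.
have S' : sextet Q X Y B C Z.
  have [sub conic] := S; split=> [U|h hh h0].
    rewrite inE => /orP[/eqP -> //|Us]; apply: sub.
    by move: Us; rewrite !inE; do 6 case: (U == _) => //.
  pose g := lin (cross B X) * lin (cross C Y).
  have gh : g \is 2.-homog.
    exact: (@dhomogM _ _ mdeg 1 _ 1 _ (lin_homog _) (lin_homog _)).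
  have gE U : ev U g = det3 B X U * det3 C Y U by rewrite evM !ev_lin.
  have gA : ev A g != 0 by rewrite gE mulf_neq0.
  have gQ : ev Q g != 0 by rewrite gE mulf_neq0.
  have hE : ev A g *: h - ev A h *: g = 0.
    apply: conic => [|U]; first by rewrite rpredB // rpredZ.
    rewrite -scaleNr evD !evZ mulNr inE => /orP[/eqP ->|Us].
      by rewrite mulrC subrr.
    rewrite (h0 U); last by move: Us; rewrite !inE; do 6 case: (U == _) => //.
    rewrite mulr0 sub0r; apply/eqP; rewrite oppr_eq0 mulf_eq0 gE mulf_eq0.
    move: Us; rewrite !inE => /or4P[|||/orP[]] /eqP ->.
    - by rewrite -[det3 B X B == 0]/(col B X B) col_idl !orbT.
    - by rewrite -[det3 C Y C == 0]/(col C Y C) col_idl !orbT.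
    - by rewrite -[det3 B X X == 0]/(col B X X) col_idr !orbT.
    - by rewrite -[det3 C Y Y == 0]/(col C Y Y) col_idr !orbT.
    - by rewrite -[det3 B X Z == 0]/(col B X Z) h3 !orbT.
  have hA : ev A h = 0.
    have : ev Q (ev A g *: h - ev A h *: g) = 0 by rewrite hE /ev meval0.
    rewrite -scaleNr evD !evZ (h0 Q) ?mem_head // mulr0 add0r.
    move/eqP; rewrite mulNr oppr_eq0 mulf_eq0 (negPf gQ) orbF => /eqP.
    exact.
  move/eqP: hE; rewrite hA scale0r subr0 scaler_eq0 (negPf gA) => /eqP.
  exact.
have hBCQ : col B C Q.
  have BA : cross B A != 0 by rewrite cross_neq0C; exact: sextet_cross S.
  rewrite -[col _ _ _]colC; apply: (@col_trans _ _ A) => //; csym.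
case: (sextet_bad_triple S') => [h|[]h|[]h|[]h].
- case/negP: nAX; apply: (@col_trans _ _ Y) => //; [exact: sextet_cross SXY | csym].
- by case/negP: nBX; csym.
- clash S' C Q B X Y Z.
- clash S' X Z B Q Y C.
- clash S' B Q C Y X Z.
- by case/negP: nCY; csym.
- clash S' Y Z C Q X B.
- clash S X Y A B C Z.
- clash S X Y A C B Z.
- clash S X Y A Z B C.
Qed.

(** If [Q] were on no side, the cubic AB, AX, ZQ would contain all seven points. A line through [Q]
    then contains at most two vertices, an opposite pair, so the system is nef and Bezout gives 35
    <= 33. *)
Lemma star_off_lines A B C X Y Z Q : star A B C X Y Z -> Q \in pts ->
  [|| col A B Q, col A X Q, col B X Q | col C Y Q].
Proof.
move=> [S h1 h2 h3 h4] Qpts; apply/norP => -[nAB /norP[nAX /norP[nBX nCY]]].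
have AB := sextet_cross S.
have AX : cross A X != 0 by apply: (@sextet_cross A X B C Y Z); reorder S.
have nline U V W : cross V W != 0 -> col U V W -> ~~ col U V Q -> ~~ col V W Q.
  by move=> VW UVW; apply: contra; exact: (col_trans VW UVW).
have nBC : ~~ col B C Q.
  by apply: (nline A) => //; apply: (@sextet_cross B C A X Y Z); reorder S.
have nAC : ~~ col A C Q.
  apply: (nline B); rewrite 1?colC //; apply: (@sextet_cross A C B X Y Z); reorder S.
have nXY : ~~ col X Y Q.
  by apply: (nline A) => //; apply: (@sextet_cross X Y A B C Z); reorder S.
have nAY : ~~ col A Y Q.
  apply: (nline X); rewrite 1?colC //; apply: (@sextet_cross A Y B X C Z); reorder S.
have nXZ : ~~ col X Z Q.
  by apply: (nline B) => //; apply: (@sextet_cross X Z A B C Y); reorder S.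
have nBZ : ~~ col B Z Q.
  apply: (nline X); rewrite 1?colC //; apply: (@sextet_cross B Z A X C Y); reorder S.
have nYZ : ~~ col Y Z Q.
  by apply: (nline C) => //; apply: (@sextet_cross Y Z A B C X); reorder S.
have nCZ : ~~ col C Z Q.
  apply: (nline Y); rewrite 1?colC //; apply: (@sextet_cross C Z A X B Y); reorder S.
pose P (o : option 'I_6) := if o is Some i then tuple6 A B C X Y Z i else Q.
have Ppts o : P o \in pts by case: o => [i|] //=; exact: sextet_pts.
have P0 o : P o != 0 by exact: pts_neq0.
have crossQ i : cross (P (Some i)) Q != 0.
  have crossQ U V : U \in pts -> ~~ col U V Q -> cross U Q != 0.
    move=> Upts; apply: contra => /eqP /(cross_eq0 (pts_neq0 Upts)) [a ->].
    rewrite /col (_ : det3 U V (a *: U) = a * det3 U V U); last first.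
      by rewrite !det3E !mxE; ring.
    by rewrite mulf_eq0 -[det3 U V U == 0]/(col U V U) col_idl orbT.
  have := sextet_pts i S; move: i; apply: ord6P => /= Upts; apply: crossQ Upts _.
  - exact: nAB.
  - exact: nBC.
  - exact: nCY.
  - exact: nXY.
  - exact: nYZ.
  - by rewrite colC; exact: nYZ.
have PP i l : i != l -> cross (P i) (P l) != 0.
  case: i l => [i|] [l|] // il.
  - exact: (unisolvent_cross _ (sextet_unisolvent S) (fun i => P0 (Some i))).
  - by rewrite cross_neq0C; exact: (crossQ l).
suff: (\sum_(o : option 'I_6) 1 * 5 <= 3 * 11)%N.
  by rewrite sum_nat_const card_option card_ord.
pose f := lin (cross A B) * (lin (cross A X) * lin (cross Z Q)).
have ZQ : cross Z Q != 0 := crossQ i5.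
apply: (@bezout_nef K _ P 3 (fun=> 1%N) [:: f] PP P0 _ _ _ _ D 11 (fun=> 5%N) D0 Dh).
- move=> g; rewrite inE => /eqP ->.
  exact: (@dhomogM _ _ mdeg 1 _ 2 _ (lin_homog _)
            (@dhomogM _ _ mdeg 1 _ 1 _ (lin_homog _) (lin_homog _))).
- move=> g o M; rewrite inE => /eqP -> MP; apply: vanishes1.
  rewrite MP !evM !ev_lin -/(det3 A B _) -/(det3 A X _).
  apply/eqP; rewrite !mulf_eq0 -!/(col _ _ _); move: o {MP} => [i|] /=; last first.
    by rewrite col_idr !orbT.
  move: i; apply: ord6P; rewrite /tuple6 /= ?col_idl ?col_idr ?h1 ?h2 ?orbT //.
- move=> c c0; rewrite big_mkcond sum_option /=.
  have [cQ|_] := boolP (dot c Q == 0); last first.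
    rewrite add0n -big_mkcond.
    exact: (@unisolvent_line _ 1 _ _ _ (erefl _) (sextet_unisolvent S)).
  have np U V : ~~ col U V Q -> ~~ ((dot c U == 0) && (dot c V == 0)).
    by apply: contra => /andP[cU cV]; exact: (col_lin c0).
  rewrite sum6n /tuple6 /=.
  move: (np _ _ nAB) (np _ _ nAC) (np _ _ nBC) (np _ _ nAX) (np _ _ nAY) (np _ _ nXY).
  move: (np _ _ nBX) (np _ _ nBZ) (np _ _ nXZ) (np _ _ nCY) (np _ _ nCZ) (np _ _ nYZ).
  clear; do 6 case: (_ == _); vm_compute => *; congruence.
- move=> D' g lf /(_ f (mem_head _ _)); rewrite -!mulrA.
  by move=> /(lin_cancel AB (lf _ AB))/(lin_cancel AX (lf _ AX))/(lin_cancel ZQ (lf _ ZQ)).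
- by move=> o M; apply: D5.
Qed.

(** Some side contains [Q] by [star_off_lines]; renaming the vertices so that this side comes first,
    [star_on_line] yields another one. *)
Lemma star_two_lines A B C X Y Z Q : star A B C X Y Z -> Q \in pts ->
  let b1 := col A B Q in let b2 := col A X Q in
  let b3 := col B X Q in let b4 := col C Y Q in
  [|| b1 && b2, b1 && b3, b1 && b4, b2 && b3, b2 && b4 | b3 && b4].
Proof.
move=> St Qpts /=; have [S h1 h2 h3 h4] := St.
have St2 : star A X Y B C Z by split; [reorder S | csym..].
have St3 : star B X Z A C Y by split; [reorder S | csym..].
have St4 : star C Y Z A B X by split; [reorder S | csym..].
have CZ : cross C Z != 0 by apply: (@sextet_cross C Z A X B Y); reorder S.
have AC : cross A C != 0 by apply: (@sextet_cross A C B X Y Z); reorder S.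
have AY : cross A Y != 0 by apply: (@sextet_cross A Y B X C Z); reorder S.
have BZ : cross B Z != 0 by apply: (@sextet_cross B Z A X C Y); reorder S.
(* The renamed quadrilaterals describe a side by another pair of its vertices; these implications
   return to the original pairs. *)
have t4 : col Z C Q -> col C Y Q.
  by move=> h; rewrite -colC; apply: (col_trans CZ); csym.
have t1 : col C A Q -> col A B Q.
  by move=> h; rewrite -colC; apply: (col_trans AC); csym.
have t2 : col Y A Q -> col A X Q.
  by move=> h; rewrite -colC; apply: (col_trans AY); csym.
have t3 : col Z B Q -> col B X Q.
  by move=> h; rewrite -colC; apply: (col_trans BZ); csym.
have := star_off_lines St Qpts; have := star_on_line St Qpts.
have := star_on_line St2 Qpts; have := star_on_line St3 Qpts.
have := star_on_line St4 Qpts; rewrite (colC B X) (colC A B) (colC A X) (colC C Y).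
move: t1 t2 t3 t4; move: (col A B Q) (col A X Q) (col B X Q) (col C Y Q).
move: (col Z C Q) (col C A Q) (col Y A Q) (col Z B Q).
do 8 case => //=; intuition discriminate.
Qed.

Lemma star_quartic A B C X Y Z : star A B C X Y Z ->
  exists2 g : {mpoly K[3]}, g != 0 /\ g \is 4.-homog & IjZ pts 2 g.
Proof.
move=> St; have [S _ _ _ _] := St.
have AB := sextet_cross S.
have AX : cross A X != 0 by apply: (@sextet_cross A X B C Y Z); reorder S.
have BX : cross B X != 0 by apply: (@sextet_cross B X A C Y Z); reorder S.
have CY : cross C Y != 0 by apply: (@sextet_cross C Y A B X Z); reorder S.
exists (lin (cross A B) * lin (cross A X) * (lin (cross B X) * lin (cross C Y))).
  split; first by rewrite !mulf_neq0 ?lin_eq0.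
  exact: (@dhomogM _ _ mdeg 2 _ 2 _
    (@dhomogM _ _ mdeg 1 _ 1 _ (lin_homog _) (lin_homog _))
    (@dhomogM _ _ mdeg 1 _ 1 _ (lin_homog _) (lin_homog _))).
move=> Q Qpts.
have two (c c' : 'rV[K]_3) r g : dot c Q == 0 -> dot c' Q == 0 ->
    g = r * (lin c * lin c') -> ideal_pow (IP Q) 2 g.
  move=> /eqP cQ /eqP cQ' ->.
  have := @ideal_pow_prod K Q [:: lin c; lin c'] r; rewrite !big_cons big_nil mulr1.
  by apply=> h; rewrite !inE => /orP[]/eqP ->; apply: (IP_ev (lin_homog _));
    rewrite ev_lin.
have := star_two_lines St Qpts; rewrite /col /det3 /=.
case/or4P => [|||/or3P[]] /andP[ca cb]; apply: (two _ _ _ _ ca cb).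
- by rewrite mulrC.
- by rewrite mulrACA mulrC.
- by rewrite [X in _ * X]mulrC mulrACA mulrC.
- by rewrite [X in X * _]mulrC mulrACA mulrC.
- by rewrite [X in X * _]mulrC [X in _ * X]mulrC mulrACA mulrC.
- by [].
Qed.

End Star.

(** * The initial degrees force p = 2 *)

Theorem theorem4p14 (K : closedFieldType) (charK0 : [pchar K] =i pred0)
  (Z : seq 'rV[K]_3) (HZ : forall P, P \in Z -> P != 0)
  (k p : nat) (hk : (5 <= k)%N)
  (Halpha : forall j : nat, (1 <= j <= k)%N ->
     is_initial_degree (IjZ Z j) (p + 2 * (j - 1))%N) :
  p = 2%N.
Proof.
have k5 j : (0 < j)%N -> (j <= 5)%N -> (1 <= j <= k)%N.
  by move=> -> j5; rewrite (leq_trans j5).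
have [[f [f0 [fh fZ]]] min1] := Halpha 1%N (k5 1%N isT isT).
have [_ min2] := Halpha 2%N (k5 2%N isT isT).
have [[D [D0 [Dh DZ]]] _] := Halpha 5%N (k5 5%N isT isT).
rewrite subnn muln0 addn0 in fh min1; rewrite subSS subn0 muln1 in min2.
rewrite (_ : 2 * (5 - 1) = 8)%N // in Dh.
have p_ge2 : (2 <= p)%N.
  rewrite leqNgt; apply/negP => p_lt2.
  have : f * f = 0.
    apply: (min2 (p + p)%N); [by rewrite ltn_add2l | exact: dhomogM |].
    move=> P PZ; have [M _ MP] := frame_exists (HZ _ PZ).
    have fP : ev P f = 0.
      by rewrite -MP; apply: vanishes_ev (ideal_pow_vanishes MP (fZ _ PZ)).
    have := @ideal_pow_prod _ P [:: f; f] 1; rewrite !big_cons big_nil mulr1 mul1r.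
    by apply=> h; rewrite !inE orbb => /eqP ->; exact: IP_ev fh fP.
  by move/eqP; rewrite mulf_eq0 orbb (negPf f0).
have noforms h : h \is p.-1.-homog -> (forall P, P \in Z -> ev P h = 0) -> h = 0.
  move=> hh hP; apply: (min1 p.-1) => //; first by rewrite prednK // ltnW.
  move=> P PZ; have := @ideal_pow_prod _ P [:: h] 1; rewrite big_seq1 mul1r.
  by apply=> g; rewrite inE => /eqP ->; exact: IP_ev hh (hP _ PZ).
have D5 Q M : Q \in Z -> row o0 M = Q -> vanishes M 5 D.
  by move=> QZ MQ; exact: ideal_pow_vanishes MQ (DZ _ QZ).
have [q pE] : exists q, p = q.+2 by exists p.-2; case: p p_ge2 {Halpha fh min1 min2 Dh noforms} => [|[]].
move: pE; case: q => [-> //|q] pE; exfalso; rewrite {}pE /= in min2 Dh noforms.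
(* Here p = q + 3, and 5 p (p + 1) / 2 <= p (p + 8) gives 3 p <= 11. *)
have q0 : q = 0%N.
  have [P PZ PU] := unisolvent_exists (erefl 'C(q.+4, 2)) noforms.
  have := @chudnovsky K q.+1 _ 5 P D PU (fun i => HZ _ (PZ i)) D0 Dh
    (fun i M => D5 _ M (PZ i)).
  by have := bin2S q.+3; nia.
rewrite {}q0 in min2 Dh noforms.
have [P PZ PU] := @unisolvent_exists K 2 6 Z (erefl _) noforms.
have S : sextet Z (P i0) (P i1) (P i2) (P i3) (P i4) (P i5).
  split=> [Q|h hh h0]; first by rewrite !inE => /or4P[| | |/or3P[]] /eqP ->.
  by apply: PU => //; apply: ord6P; apply: h0; rewrite !inE eqxx ?orbT.
have [A [B [C [X [Y [V St]]]]]] := star_exists HZ D0 Dh D5 S.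
have [g [g0 gh] gZ] := star_quartic HZ D0 Dh D5 St.
by case/eqP: g0; exact: (min2 4%N).
Qed.
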